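(* Let $k\geq 2$ be an integer and let $c_{k}=\sqrt{k(k-1)(k+2\sqrt{2k}+2)}$. Let $n_{1}(k)$ be the smallest positive integer such that $\frac{n+2k-2}{4}-2c_{k}\sqrt{n}-k^{2}-2k-1\geq 0$ for every integer $n\geq n_{1}(k)$. Let $G$ be a connected graph of order $n\geq n_{1}(k)$ with $\sigma_{2}(G)\geq \frac{n+2k-2}{2}$. Then $G$ has a $[2,k]$-ST if and only if $G$ has no $k$-blocking set.
   Context: All graphs are finite and simple. For a graph $G$ and $u\in V(G)$, $d_G(u)$ is the degree of $u$. If $G$ is not complete, $\sigma_{2}(G)=\min\{d_{G}(u)+d_{G}(v): u,v\in V(G),\ u\neq v,\ uv\notin E(G)\}$; if $G$ is complete, $\sigma_2(G)=\infty$. A $[2,k]$-ST of $G$ is a spanning tree $T$ of $G$ having no vertex whose degree in $T$ lies in $\{2,3,\dots,k\}$. For a connected graph $G$, a $k$-blocking set is a cutset $U\subseteq V(G)$ (a vertex set whose removal disconnects $G$) such that every vertex $u\in U$ satisfies $2\leq d_G(u)\leq k$. *)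

(* Defs.v *)
From HB Require Import structures.
From mathcomp Require Import all_boot all_order all_algebra.
From mathcomp Require Import boolp constructive_ereal reals.
From mathcomp Require Import lra.

Set Implicit Arguments.
Unset Strict Implicit.
Unset Printing Implicit Defensive.

Import Order.TTheory GRing.Theory Num.Theory.
Local Open Scope ring_scope.

Section Graphs.
Variable V : finType.
Implicit Types (E T : rel V) (U : {set V}) (k : nat).

Definition simple_graph E : Prop := symmetric E /\ irreflexive E.

Definition degree E (u : V) : nat := #|[set v | E u v]|.

Definition graph_connected E : Prop :=
  (0 < #|V|)%N /\ forall x y : V, connect E x y.

(* A cycle has at least 3 vertices: [ucycle] also accepts [::] and [:: x; y]
   for every edge xy. *)
Definition acyclic E : Prop :=
  forall c : seq V, (2 < size c)%N -> ~ ucycle E c.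

Definition spanning_tree E T : Prop :=
  [/\ simple_graph T, subrel T E, graph_connected T & acyclic T].

Definition has_2k_ST k E : Prop :=
  exists2 T : rel V, spanning_tree E T
    & forall v : V, ~ (2 <= degree T v <= k)%N.

Definition delete_vertices E U : rel V :=
  [rel x y | [&& x \notin U, y \notin U & E x y]].

Definition cutset E U : Prop :=
  exists x y : V,
    [/\ x \notin U, y \notin U & ~ connect (delete_vertices E U) x y].

Definition blocking_set k E U : Prop :=
  cutset E U /\ forall u, u \in U -> (2 <= degree E u <= k)%N.

(* The empty minimum, i.e. the case of a complete graph, is +oo. *)
Definition sigma2 (R : realType) E : \bar R :=
  \big[Order.min/+oo%E]_(p : V * V | (p.1 != p.2) && ~~ E p.1 p.2)
    ((degree E p.1 + degree E p.2)%:R)%:E.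

End Graphs.

Section Threshold.
Variable R : realType.

Definition c_ (k : nat) : R :=
  Num.sqrt (k%:R * (k%:R - 1) * (k%:R + 2 * Num.sqrt (2 * k%:R) + 2)).

Definition eventually_nonneg (k m : nat) : Prop :=
  forall n : nat, (m <= n)%N ->
    0 <= (n%:R + 2 * k%:R - 2) / 4 - 2 * c_ k * Num.sqrt n%:R
         - k%:R ^+ 2 - 2 * k%:R - 1 :> R.

Definition is_n1 (k m : nat) : Prop :=
  [/\ (0 < m)%N, eventually_nonneg k m
    & forall m' : nat, (0 < m')%N -> eventually_nonneg k m' -> (m <= m')%N].

Lemma n1_exists (k : nat) : (2 <= k)%N -> exists m, is_n1 k m.
Proof.
move=> k2.
have ex : exists m, (0 < m)%N && `[< eventually_nonneg k m >].
  have c0 : 0 <= c_ k by exact: sqrtr_ge0.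
  have K2 : 2 <= k%:R :> R by rewrite ler_nat.
  pose A := 8 * c_ k + 4 * (k%:R + 1) ^+ 2 + 1.
  have A0 : 1 <= A.
    have := sqr_ge0 (k%:R + 1 : R); rewrite /A; move: ((k%:R + 1) ^+ 2) => q q0.
    by lra.
  exists (Num.bound (A ^+ 2)).+1; rewrite ltn0Sn /=; apply/asboolP => n ln.
  have hn : A ^+ 2 <= n%:R.
    have : 0 <= A ^+ 2 by apply: sqr_ge0.
    move=> /archi_boundP /ltW /le_trans; apply.
    by rewrite ler_nat ltnW.
  set s := Num.sqrt n%:R.
  have sn : s ^+ 2 = n%:R by rewrite sqr_sqrtr.
  have sA : A <= s by rewrite -(ger0_norm (le_trans ler01 A0)) -sqrtr_sqr ler_sqrt.
  have s1 : 1 <= s by exact: le_trans sA.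
  have h1 : 0 <= s * (s - A) by rewrite mulr_ge0 ?subr_ge0 // (le_trans ler01).
  have h2 : 0 <= (s - 1) * (k%:R + 1) ^+ 2.
    by apply: mulr_ge0; [rewrite subr_ge0 | exact: sqr_ge0].
  rewrite -sn; move: h1 h2; rewrite /A => h1 h2.
  by nra.
exists (ex_minn ex); case: ex_minnP => m /andP[m0 /asboolP Pm] mn.
by split=> // m' m'0 Pm'; apply: mn; rewrite m'0; apply/asboolP.
Qed.

End Threshold.

(* Main.v *)
Require Import Defs.
From mathcomp Require Import all_boot all_order all_algebra.
From mathcomp Require Import constructive_ereal reals.
From mathcomp Require Import boolp zify lra.
Import Order.TTheory GRing.Theory Num.Theory.

Set Implicit Arguments.
Unset Strict Implicit.
Unset Printing Implicit Defensive.

(** Write n for the order of the graph, B for the set of vertices of degree at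
    most k, and Q for the set of vertices of degree less than n/10; the Ore-type
    condition makes Q a clique.  Vertices of B must be leaves of a [2,k]-ST, so a
    blocking set is an obstruction.  Without one, G - B is connected and every
    vertex of B has a neighbour outside B.

    The tree is built around a connected set I of inner vertices dominating G:
    if every vertex of I has k private neighbours outside I, a spanning tree of
    G[I] together with pendant edges is a [2,k]-ST.  When I has at most about
    n/(10(k+1)) vertices the private neighbours are found greedily, except for
    the members of Q.  A small I exists because, fixing a centre c, every
    non-neighbour of c sees a constant fraction of the graph: a greedy choice of
    O(log n) vertices dominates them, and vertices with so many neighbours cannot
    have pairwise disjoint neighbourhoods, so few connectors are needed.

    If Q = B, all of I avoids Q.  Otherwise G - Q has at most two components, and
    one or two vertices of Q - B are needed to connect them.  A breadth-first
    tree rooted at such a vertex keeps all its edges to I.  In the case of two,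
    the degree sum condition applied to vertices far from Q shows that they have
    enough neighbours to serve both: this is where the term 2k - 2 is tight. *)

(** * The threshold *)

(** The exponent [m.+1] is the least one satisfying the first inequality, and minimality gives the
    second: [n] is at least exponential in [m], so [m] is logarithmic in [n]. *)
Lemma exp_beats (a b n : nat) : a < b -> 0 < n ->
  exists2 m, n * a ^ m.+1 < b ^ m.+1 & b ^ m <= n * a ^ m.
Proof.
move=> ab n0.
(* Bernoulli's inequality [(b / a) ^ m >= 1 + m / a], cleared of fractions; it shows that some
   exponent works. *)
have bern m : a ^ m * (a + m) <= a * b ^ m.
  elim: m => [|m IH]; first by rewrite !expn0; lia.
  rewrite !expnS; have : b ^ m * a.+1 <= b ^ m * b by rewrite leq_mul2l ab orbT.
  have : a ^ m <= b ^ m by case: m {IH} => [|m]; rewrite ?expn0 // leq_exp2r // ltnW.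
  by nia.
have ex : exists m, n * a ^ m < b ^ m.
  exists (n * a).+1; case: a => [|a] in ab bern *.
    by rewrite exp0n // muln0 expn_gt0 ab.
  have := bern (n * a.+1).+1; set x := _ ^ _; set y := b ^ _.
  have x0 : 0 < x by rewrite expn_gt0.
  by nia.
case: (ex_minnP ex) => -[|m] hm min; first by rewrite !expn0 in hm; lia.
by exists m => //; rewrite leqNgt; apply/negP => /min; rewrite ltnn.
Qed.

(** The factor is [30 * (3 / 2 * m.+1 + 8)], the size required of [n] for [k = 2] in
    [large_order_thirds]. *)
Lemma linear_le_exp (m : nat) : 18 <= m -> (45 * m.+1 + 240) * 2 ^ m <= 3 ^ m.
Proof.
elim: m => // m IH; rewrite leq_eqVlt => /orP[/eqP <-|mm]; first by lia.
have {}IH := IH mm.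
have h : (45 * m.+2 + 240) * 2 <= (45 * m.+1 + 240) * 3 by nia.
rewrite !expnS; move: (2 ^ m) (3 ^ m) IH => x y IH.
by have := leq_mul h (leqnn x); lia.
Qed.

Lemma square_le_exp (m : nat) : 21 <= m -> 7 * (m.+1 * m.+1) * 2 ^ m <= 3 ^ m.
Proof.
elim: m => // m IH; rewrite leq_eqVlt => /orP[/eqP <-|mm]; first by lia.
have {}IH := IH mm.
have h : (7 * (m.+2 * m.+2)) * 2 <= (7 * (m.+1 * m.+1)) * 3 by nia.
rewrite !expnS; move: (2 ^ m) (3 ^ m) IH => x y IH.
by have := leq_mul h (leqnn x); lia.
Qed.

(** The factor is twice [21 * (3 / 2 * m.+1 + 8)], the size required of [n] for [k = 2] in
    [large_order_quarters]. *)
Lemma linear_le_exp25 (m : nat) : 26 <= m ->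
  (63 * m.+1 + 336) * 19 ^ m <= 2 * 25 ^ m.
Proof.
elim: m => // m IH; rewrite leq_eqVlt => /orP[/eqP <-|mm]; first by lia.
have {}IH := IH mm.
have h : (63 * m.+2 + 336) * 19 <= (63 * m.+1 + 336) * 25 by nia.
rewrite !expnS; move: (19 ^ m) (25 ^ m) IH => x y IH.
by have := leq_mul h (leqnn x); lia.
Qed.

Lemma square_le_exp25 (m : nat) : 30 <= m ->
  3 * (m.+1 * m.+1) * 19 ^ m <= 25 ^ m.
Proof.
elim: m => // m IH; rewrite leq_eqVlt => /orP[/eqP <-|mm]; first by lia.
have {}IH := IH mm.
have h : (3 * (m.+2 * m.+2)) * 19 <= (3 * (m.+1 * m.+1)) * 25 by nia.
rewrite !expnS; move: (19 ^ m) (25 ^ m) IH => x y IH.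
by have := leq_mul h (leqnn x); lia.
Qed.

(* What is used of the threshold n1(k): sqrt (2k) is bounded below by 2. *)
Definition large_order (k n : nat) : Prop :=
  64 * (k * k.-1 * (k + 6)) + 4 * k.+1 ^ 2 + 2 <= n + 2 * k.

(** After [m] greedy steps, each leaving at most two thirds undominated, none of [n] vertices is
    left; the second bound lets [m + m./2 + k + 6] inner vertices find [k] leaves each among
    [n %/ 10] neighbours. *)
Lemma large_order_thirds (k n : nat) : 2 <= k -> large_order k n ->
  exists2 m, n * 2 ^ m < 3 ^ m & k.+1 * (m + m./2 + k + 6) <= n %/ 10.
Proof.
rewrite /large_order => k2 hn.
have [|m m1 m2] := @exp_beats 2 3 n erefl; first by nia.
exists m.+1 => //; rewrite leq_divRL //.
have half : 2 * (m.+1)./2 <= m.+1 by lia.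
have p0 : 0 < 2 ^ m by rewrite expn_gt0.
have [k3|k3] := leqP 3 k.
  have hm : 7 * (m.+1 * m.+1) <= n.
    have [m21|m21] := leqP 21 m; last by nia.
    by have := square_le_exp m21; nia.
  have k1 : k.-1 = k - 1 by lia.
  rewrite k1 in hn.
  (* The mixed term is split by the arithmetic-geometric mean inequality: the square in [m] is paid
     for by exponential growth, the terms in [k] by the cubic lower bound on [n]. *)
  have amgm : 30 * (k.+1 * m.+1) <= 7 * (m.+1 * m.+1) + 33 * (k.+1 * k.+1).
    move: m.+1 k.+1 => a b; have := (nat_Cauchy (7 * a) (15 * b)).1; rewrite -!mulnn.
    by clear; nia.
  have kn : 33 * (k.+1 * k.+1) + 20 * (k.+1 * (k + 6)) <= n.
    have [j kj] : exists j, k = j + 3 by exists (k - 3); lia.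
    by rewrite kj in hn *; move: hn; clear; rewrite -mulnn; nia.
  by move: half amgm hm kn; clear; move: (m.+1)./2 (m.+1) => h a; nia.
(* Here [large_order] only gives [n >= 1058], so the bound is kept linear in [m]; [45 * m.+1 + 240]
   is at most 1050 when [m <= 17]. *)
have -> : k = 2 by lia.
have hk : k = 2 by lia.
rewrite hk in hn.
have [m18|m18] := leqP 18 m; last by lia.
by have := linear_le_exp m18; nia.
Qed.

(** The variant for a centre of degree at least [n / 7], when a non-neighbour is only known to see
    about a quarter of the graph; [19 / 25] exceeds [3 / 4] slightly to absorb rounding and the
    small vertices. *)
Lemma large_order_quarters (k n : nat) : 2 <= k -> large_order k n ->
  exists2 m, n * 19 ^ m < 25 ^ m & 7 * (k.+1 * (m + m./2 + k + 6)) <= n.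
Proof.
rewrite /large_order => k2 hn.
have [|m m1 m2] := @exp_beats 19 25 n erefl; first by nia.
exists m.+1 => //.
have half : 2 * (m.+1)./2 <= m.+1 by lia.
have p0 : 0 < 19 ^ m by rewrite expn_gt0.
have [k3|k3] := leqP 3 k.
  have hm : 3 * (m.+1 * m.+1) <= n.
    have [m30|m30] := leqP 30 m; last by nia.
    by have := square_le_exp25 m30; nia.
  have k1 : k.-1 = k - 1 by lia.
  rewrite k1 in hn.
  have amgm : 21 * (k.+1 * m.+1) <= 3 * (m.+1 * m.+1) + 37 * (k.+1 * k.+1).
    move: m.+1 k.+1 => a b; have := (nat_Cauchy (6 * a) (21 * b)).1; rewrite -!mulnn.
    by clear; nia.
  have kn : 37 * (k.+1 * k.+1) + 14 * (k.+1 * (k + 6)) <= n.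
    have [j kj] : exists j, k = j + 3 by exists (k - 3); lia.
    by rewrite kj in hn *; move: hn; clear; rewrite -mulnn; nia.
  by move: half amgm hm kn; clear; move: (m.+1)./2 (m.+1) => h a; nia.
have -> : k = 2 by lia.
have hk : k = 2 by lia.
rewrite hk in hn.
have [m26|m26] := leqP 26 m; last by lia.
by have := linear_le_exp25 m26; nia.
Qed.

Lemma large_order_n1 (R : realType) (k n1 n : nat) :
  2 <= k -> is_n1 R k n1 -> n1 <= n -> large_order k n.
Proof.
move=> k2 [_ + _] n1n => /(_ n n1n).
have K2 : (2 <= k%:R :> R)%R by rewrite ler_nat.
rewrite /c_; set t := Num.sqrt (2 * _)%R; set c := Num.sqrt (_ * _)%R;
  set s := Num.sqrt _.
have s0 : (0 <= s)%R by exact: sqrtr_ge0.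
have c0 : (0 <= c)%R by exact: sqrtr_ge0.
have t0 : (0 <= t)%R by exact: sqrtr_ge0.
have sE : (s ^+ 2 = n%:R)%R by rewrite sqr_sqrtr.
have tE : (t ^+ 2 = 2 * k%:R)%R by rewrite sqr_sqrtr //; lra.
have t2 : (2 <= t)%R by nra.
have kk0 : (0 <= k%:R * (k%:R - 1) :> R)%R by nra.
have cE : (c ^+ 2 = k%:R * (k%:R - 1) * (k%:R + 2 * t + 2))%R.
  by rewrite sqr_sqrtr // mulr_ge0 //; lra.
have c2 : (k%:R * (k%:R - 1) * (k%:R + 6) <= c ^+ 2)%R.
  by rewrite cE ler_wpM2l //; lra.
rewrite -sE => h.
have k1 : (k.-1%:R = k%:R - 1 :> R)%R by rewrite -[in RHS](ltn_predK k2) -natr1; lra.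
(* By [h] the product [s * (s - 8 * c)] is positive; feeding [s >= 8 * c] back into [h] replaces
   [8 * c * s] by [64 * c ^ 2]. *)
have s8 : (8 * c <= s)%R.
  have [//|lt] := leP (8 * c)%R s; exfalso.
  have : (s * (s - 8 * c) <= 0)%R by rewrite mulr_ge0_le0 // subr_le0 ltW.
  by nra.
have sc : (64 * c ^+ 2 <= 8 * c * s)%R.
  by rewrite -subr_ge0 [leRHS](_ : _ = 8 * c * (s - 8 * c))%R;
    [rewrite !mulr_ge0 ?subr_ge0 | nra].
rewrite /large_order -(ler_nat R) !(natrD, natrM, natrX) k1 -(natr1 k) -sE.
move: (k%:R)%R (k%:R * (k%:R - 1) * (k%:R + 6))%R h sc c2 => K X.
by nra.
Qed.

(** * Connectivity and rooted trees *)

Definition nbrs (V : finType) (E : rel V) (x : V) : {set V} := [set y | E x y].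

Definition induced (V : finType) (E : rel V) (A : {set V}) : rel V :=
  fun x y => [&& x \in A, y \in A & E x y].
Arguments induced V E A x y /.

Definition connected_on (V : finType) (E : rel V) (A : {set V}) : Prop :=
  forall x y, x \in A -> y \in A -> connect (induced E A) x y.

Section Trees.
Variable V : finType.
Implicit Types (E T : rel V) (A I K P S Y : {set V}) (x y v : V).

Lemma in_nbrs E x y : (y \in nbrs E x) = E x y.
Proof. by rewrite inE. Qed.

Lemma induced_sym E A : symmetric E -> symmetric (induced E A).
Proof. by move=> sE x y; rewrite /= sE andbCA. Qed.

Lemma connect_induced_sub E A A' x y : A \subset A' ->
  connect (induced E A) x y -> connect (induced E A') x y.
Proof.
move=> /subsetP sA; apply: connect_sub => u v /and3P[uA vA uv].
by apply: connect1; rewrite /= !sA.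
Qed.

Lemma connected_on1 E x : connected_on E [set x].
Proof. by move=> u v /set1P -> /set1P ->; exact: connect0. Qed.

Lemma connected_on_root E A c : symmetric E ->
  (forall x, x \in A -> connect (induced E A) c x) -> connected_on E A.
Proof.
move=> sE h x y xA yA; apply: connect_trans (h _ yA).
by rewrite (sym_connect_sym (induced_sym A sE)) h.
Qed.

Lemma connected_onU E A A' x y : symmetric E ->
  connected_on E A -> connected_on E A' -> x \in A -> y \in A' -> E x y ->
  connected_on E (A :|: A').
Proof.
move=> sE cA cA' xA yA' xy; apply: (@connected_on_root _ _ x) => // z /setUP[zA|zA'].
  by apply: connect_induced_sub (cA _ _ xA zA); rewrite subsetUl.
have zz : connect (induced E (A :|: A')) y z.
  by apply: connect_induced_sub (cA' _ _ yA' zA'); rewrite subsetUr.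
by apply: connect_trans zz; apply: connect1; rewrite /= !inE xA yA' xy orbT.
Qed.

Lemma connected_on_dominated E A A' : symmetric E -> connected_on E A ->
  (forall x, x \in A' -> x \notin A -> exists2 y, y \in A & E y x) ->
  connected_on E (A :|: A').
Proof.
move=> sE cA dA u v.
have toA w : w \in A :|: A' ->
    exists2 a, a \in A & connect (induced E (A :|: A')) a w /\
                         connect (induced E (A :|: A')) w a.
  move=> wAA; have [wA|wA] := boolP (w \in A); first by exists w.
  have [|y yA yw] := dA w _ wA; first by case/setUP: wAA wA => // ->.
  exists y => //; split; apply: connect1; rewrite /= ?(sE w) yw !inE yA.
    by move: wAA; rewrite inE => ->.
  by move: wAA; rewrite inE => ->.
move=> /toA[a aA [_ ua]] /toA[b bA [bv _]].
apply: (connect_trans ua); apply: connect_trans bv.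
by apply: connect_induced_sub (cA _ _ aA bA); rewrite subsetUl.
Qed.

Lemma connect_exit (e : rel V) K x y :
  connect e x y -> x \in K -> y \notin K ->
  exists u v, [/\ u \in K, v \notin K & e u v].
Proof.
case/connectP => p + -> {y}; elim: p x => [|z p IH] x /=; first by move=> _ ->.
move=> /andP[xz zp] xK lK; have [zK|zK] := boolP (z \in K); last by exists x, z.
exact: IH zp zK lK.
Qed.

Lemma connected_on_exit E P K x y : connected_on E P ->
  x \in P -> y \in P -> x \in K -> y \notin K ->
  exists u v, [/\ u \in P :&: K, v \in P :\: K & E u v].
Proof.
move=> cP xP yP xK yK;
  have [u [v [uK vK /and3P[uP vP uv]]]] := connect_exit (cP _ _ xP yP) xK yK.
by exists u, v; rewrite !inE uP uK vK vP.
Qed.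

(** An inner vertex of a path has two distinct neighbours on it, so its degree exceeds 1. This
    serves both for leaves of a tree and for vertices left with degree at most 1 by a deletion. *)
Lemma path_avoid (e : rel V) (S : pred V) x p : symmetric e ->
  (forall v, S v -> degree e v <= 1) ->
  path e x p -> uniq (x :: p) -> ~~ S x -> ~~ S (last x p) -> all (predC S) p.
Proof.
move=> se dS; elim: p x => //= y p IH x /andP[xy yp] /andP[xyp up] Sx Sl.
have Sy : ~~ S y.
  case: p => [|z p] // in yp xyp Sl {IH up} *; apply/negP => /dS.
  rewrite leqNgt => /negP; apply; rewrite /degree (cardD1 x) (cardD1 z) !inE.
  move: yp => /= /andP[-> _]; rewrite se xy eq_sym.
  by move: xyp; rewrite !inE !negb_or => /and3P[_ ->].
by rewrite Sy; exact: IH yp up Sy Sl.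
Qed.

Lemma connect_avoid (e : rel V) (S : pred V) x y : symmetric e ->
  (forall v, S v -> degree e v <= 1) -> connect e x y -> ~~ S x -> ~~ S y ->
  connect [rel u v | [&& ~~ S u, ~~ S v & e u v]] x y.
Proof.
move=> se dS /connectP[p0 /shortenP[p xp up _] ->] Sx Sl.
have /allP av := path_avoid se dS xp up Sx Sl.
apply/connectP; exists p => //; elim: p x xp Sx av {up Sl p0} => //= z p IH x.
move=> /andP[xz zp] Sx av; have Sz : ~~ S z by apply: av; rewrite inE eqxx.
by rewrite Sx Sz xz /= IH // => w wp; apply: av; rewrite inE wp orbT.
Qed.

(** * Spanning trees given by a parent function with decreasing rank *)

Section ParentTree.
Variables (E : rel V) (r : V) (par : V -> V) (rank : V -> nat).
Hypothesis sE : symmetric E.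
Hypothesis iE : irreflexive E.
Hypothesis Epar : forall v, v != r -> E v (par v).
Hypothesis rank_par : forall v, v != r -> rank (par v) < rank v.

Definition parent_tree : rel V :=
  fun x y => (x != r) && (par x == y) || (y != r) && (par y == x).
Arguments parent_tree x y /.

Lemma parent_tree_sym : symmetric parent_tree.
Proof. by move=> x y; rewrite /= orbC. Qed.

Lemma parent_tree_sub : subrel parent_tree E.
Proof.
by move=> x y /orP[] /andP[/Epar h /eqP <-] //; rewrite sE.
Qed.

Lemma parent_tree_connected x y : connect parent_tree x y.
Proof.
have toR v : connect parent_tree v r.
  have [m] := ubnP (rank v); elim: m v => // m IH v; rewrite ltnS => vm.
  have [->|vr] := eqVneq v r; first exact: connect0.
  apply: connect_trans (IH (par v) (leq_trans (rank_par vr) vm)).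
  by apply: connect1; rewrite /= vr eqxx.
by apply: connect_trans (toR x) _; rewrite (sym_connect_sym parent_tree_sym).
Qed.

(* On a cycle, both neighbours of a vertex of maximal rank are its parent. *)
Lemma parent_tree_acyclic : acyclic parent_tree.
Proof.
move=> c sc /andP[cc uc].
have [x0 x0c] : exists x, x \in c by case: c sc {cc uc} => // x c; exists x;
  rewrite inE eqxx.
case: (@arg_maxnP _ x0 (mem c) rank x0c) => x xc max.
have [i p cE] := rot_to xc.
have cr : cycle parent_tree (x :: p) by rewrite -cE rot_cycle.
have ur : uniq (x :: p) by rewrite -cE rot_uniq.
have memc y : y \in x :: p -> rank y <= rank x.
  by rewrite -cE mem_rot => yc; exact: max.
have sp : 1 < size p by have := size_rot i c; rewrite cE /= => h; move: sc;
  rewrite -h.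
have nb y : y \in x :: p -> parent_tree x y -> y = par x.
  move=> /memc yx /orP[/andP[_ /eqP //]|/andP[/rank_par + /eqP yE]].
  by rewrite yE ltnNge yx.
case/lastP: p => [|[|y p] z] // in cr ur memc sp nb {cE} *.
move: cr => /= /andP[xy]; rewrite rcons_path => /andP[_]; rewrite last_rcons => zx.
have yE := nb y; have zE := nb z.
rewrite yE // in ur; last by rewrite !inE eqxx orbT.
rewrite zE ?(parent_tree_sym x) // in ur;
  last by rewrite !inE mem_rcons inE eqxx !orbT.
by move: ur; rewrite /= mem_rcons inE eqxx !andbF.
Qed.

Lemma parent_tree_spanning : 0 < #|V| -> spanning_tree E parent_tree.
Proof.
move=> V0; split; [split | exact: parent_tree_sub | split | exact:
  parent_tree_acyclic] => //.
- exact: parent_tree_sym.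
- by move=> x; apply/negP => /parent_tree_sub; rewrite iE.
- exact: parent_tree_connected.
Qed.

Definition children v : {set V} := [set u | (u != r) && (par u == v)].

Lemma parent_tree_degree v : degree parent_tree v = (v != r) + #|children v|.
Proof.
have [->|vr] := eqVneq v r.
  by apply: eq_card => u; rewrite !inE /= eqxx.
rewrite /degree (cardD1 (par v)) !inE /= vr eqxx /=; congr (_ + _).
apply: eq_card => u; rewrite !inE /= (eq_sym _ u).
(* [par v] is not also a child of [v], since the rank drops from a vertex to its parent; so the
   parent and the children are counted separately. *)
have [->|//] := eqVneq u (par v); symmetry; apply/negP => /andP[pr /eqP ppv].
have := rank_par pr; rewrite ppv; have := rank_par vr; lia.
Qed.

End ParentTree.

(** [rank] is the distance from [r] inside [I], and [par] picks a neighbour one step closer. The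
    last two clauses later force the parents of vertices near [r]. *)
Lemma bfs_parent E I r : connected_on E I -> r \in I ->
  exists (par : V -> V) (rank : V -> nat),
  [/\ forall v, v \in I -> v != r -> [/\ par v \in I, E (par v) v & rank v = (rank
    (par v)).+1],
      rank r = 0, forall v, v \in I -> rank v = 0 -> v = r
    & forall u v, u \in I -> v \in I -> E u v -> rank v <= (rank u).+1].
Proof.
move=> cI rI.
pose reach n v := `[< exists2 p, path (induced E I) r p & last r p = v /\ size p = n
  >].
have ex v : v \in I -> exists n, reach n v.
  move=> vI; have /connectP[p rp ->] := cI _ _ rI vI.
  by exists (size p); apply/asboolP; exists p.
(* The minimum needs the proof that [v] lies in [I]; the value 0 outside [I] is only a default. *)
pose rank v := if @idP (v \in I) is ReflectT vI then ex_minn (ex v vI) else 0.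
have rankP v : v \in I -> reach (rank v) v /\ forall m, reach m v -> rank v <= m.
  by move=> vI; rewrite /rank; case: {-}_ / idP => // vI'; case: ex_minnP.
have r0 : rank r = 0.
  apply/eqP; rewrite -leqn0; apply (rankP r rI).2; apply/asboolP.
  by exists [::].
have r0' v : v \in I -> rank v = 0 -> v = r.
  move=> vI v0; have [/asboolP[p _ [lp sp]] _] := rankP v vI.
  by move: sp lp; rewrite v0 => /size0nil -> <-.
have step u v : u \in I -> v \in I -> E u v -> rank v <= (rank u).+1.
  move=> uI vI uv; apply (rankP v vI).2.
  have [/asboolP[p rp [lp sp]] _] := rankP u uI.
  apply/asboolP; exists (rcons p v); last by rewrite last_rcons size_rcons sp.
  by rewrite rcons_path rp /= lp uI vI uv.
have parP v : v \in I -> v != r ->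
    exists u, [/\ u \in I, E u v & rank v = (rank u).+1].
  move=> vI vr; have [/asboolP[p rp [lp sp]] _] := rankP v vI.
  case/lastP: p rp lp sp => [|p w]; first by move=> _ /= rv; rewrite rv eqxx in vr.
  rewrite rcons_path last_rcons size_rcons => /andP[rp /and3P[lI wI lw]] wv sp.
  exists (last r p); rewrite wv in lw *; split=> //.
  apply/eqP; rewrite eqn_leq step //= -sp ltnS.
  by apply (rankP _ lI).2; apply/asboolP; exists p.
pose par v := if pselect (exists u, [/\ u \in I, E u v & rank v = (rank u).+1]) is
  left h
              then projT1 (cid h) else v.
exists par, rank; split=> // v vI vr; rewrite /par.
by case: pselect => [h|/(_ (parP v vI vr))//]; case: cid => u [].
Qed.

End Trees.

(** * Small connected dominating sets *)

Section Domination.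
Variables (V : finType) (E : rel V).
Hypothesis sE : symmetric E.
Hypothesis iE : irreflexive E.
Implicit Types (A C D I K P S W Y : {set V}).

Lemma card_setI_sum A W : #|A :&: W| = \sum_(w in W) (w \in A).
Proof.
rewrite -sum1_card (eq_bigl (fun x => (x \in W) && (x \in A))); last first.
  by move=> x; rewrite inE andbC.
by rewrite big_mkcondr; apply: eq_bigr => x _; case: (x \in A).
Qed.

Lemma double_count P W :
  \sum_(x in P) #|nbrs E x :&: W| = \sum_(w in W) #|nbrs E w :&: P|.
Proof.
under eq_bigr do rewrite card_setI_sum.
rewrite exchange_big; apply: eq_bigr => w _; rewrite card_setI_sum.
by apply: eq_bigr => x _; rewrite !in_nbrs sE.
Qed.

Lemma leq_sum_nbrs P W th :
  (forall w, w \in W -> th <= #|nbrs E w :&: P|) ->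
  #|W| * th <= \sum_(x in P) #|nbrs E x :&: W|.
Proof. by move=> h; rewrite double_count -sum_nat_const; exact: leq_sum. Qed.

(** Averaging: at least [#|W| * th] pairs join [W] to [P], so some vertex of [P] has at least the
    mean share. *)
Lemma heavy_vertex P W th : 0 < #|P| ->
  (forall w, w \in W -> th <= #|nbrs E w :&: P|) ->
  exists2 x, x \in P & th * #|W| <= #|P| * #|nbrs E x :&: W|.
Proof.
move=> P0 h; apply: contrapT => no.
have : \sum_(x in P) (#|P| * #|nbrs E x :&: W|).+1 <= \sum_(x in P) th * #|W|.
  by apply: leq_sum => x xP; rewrite ltnNge; apply/negP => le; apply: no; exists x.
rewrite sum_nat_const; under eq_bigr do rewrite -addn1.
rewrite big_split /= -big_distrr /= sum1_card; have := leq_sum_nbrs h.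
by nia.
Qed.

Definition undominated Y D := [set y in Y | nbrs E y :&: D == set0].

(* Each greedy step keeps at most the fraction [a / b] of [Y] undominated. *)
Lemma greedy_domination P Y th a b m : 0 < #|P| ->
  (forall y, y \in Y -> th <= #|nbrs E y :&: P|) ->
  b * #|P| <= b * th + a * #|P| ->
  exists D, [/\ D \subset P, #|D| <= m
    & #|undominated Y D| * b ^ m <= #|Y| * a ^ m].
Proof.
move=> P0 hY hab; elim: m => [|m [D [DP Dm IH]]].
  exists set0; rewrite sub0set cards0 !expn0 !muln1; split=> //.
  by apply: subset_leq_card; apply/subsetP => y; rewrite !inE => /andP[].
have [|x xP hx] := @heavy_vertex P (undominated Y D) th P0.
  by move=> w; rewrite inE => /andP[wY _]; exact: hY.
exists (x |: D); split.
- by rewrite subUset sub1set xP.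
- by rewrite cardsU1; case: (x \notin D) => /=; lia.
have : #|undominated Y (x |: D)| + #|nbrs E x :&: undominated Y D| <= #|undominated Y
  D|.
  rewrite -(cardsID (nbrs E x) (undominated Y D)) setIC addnC leq_add2l.
  apply: subset_leq_card; apply/subsetP => y; rewrite !inE => /andP[yY /eqP y0].
  have n z : z \in x |: D -> ~~ E y z.
    by move=> zD; have := in_set0 z; rewrite -y0 inE in_nbrs zD andbT => ->.
  rewrite yY sE n ?setU11 //=; apply/eqP/setP => z; rewrite !inE.
  by apply/negP => /andP[yz zD]; move: (n z); rewrite setU1r // yz => /(_ isT).
move: IH hx; set w' := #|undominated Y (x |: D)|; set w := #|undominated _ _|.
set t := #|_ :&: _|; move: P0 hab; move: #|P| => p p0 hab.
rewrite !expnS.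
move: (b ^ m) (a ^ m) #|Y| => B A y IH hx ht.
(* The new vertex catches at least the fraction [th / p] of the undominated set, and [hab] says
   [1 - th / p <= a / b]. *)
have step : b * w' <= a * w.
  rewrite -(leq_pmul2l p0).
  have : p * w' + p * t <= p * w by rewrite -mulnDr leq_mul2l ht orbT.
  have : w * (b * p) <= w * (b * th + a * p) by rewrite leq_mul2l hab orbT.
  by clear -hx; nia.
have : (b * w') * B <= (a * w) * B by rewrite leq_mul2r step orbT.
have : a * (w * B) <= a * (y * A) by rewrite leq_mul2l IH orbT.
by lia.
Qed.

(* Ore: an inclusion-minimal dominating set and its complement both dominate. *)
Lemma half_domination A C :
  (forall x, x \in A -> exists2 y, y \in A :|: C & E x y) ->
  exists S, [/\ S \subset A, 2 * #|S| <= #|A|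
    & forall x, x \in A -> x \in S \/ exists2 y, y \in S :|: C & E x y].
Proof.
move=> hA; pose dom S := [forall x in A, (x \in S) || [exists y in S :|: C, E x y]].
have domP S x : dom S -> x \in A -> x \in S \/ exists2 y, y \in S :|: C & E x y.
  by move=> /'forall_implyP /(_ x) h /h /orP[|/exists_inP[y]]; [left | right;
    exists y].
have domA : dom A by apply/'forall_implyP => x ->.
have [S /minsetP[dS minS] SA] := minset_exists domA.
(* If [s] had no neighbour in [A :\: S], then [S :\ s] would still dominate: every vertex of [A]
   adjacent to [s] lies in [S], and [s] itself has a neighbour in [A] or [C]. This contradicts
   minimality. *)
have out s : s \in S -> exists2 y, y \in A :\: S & E s y.
  move=> sS; have sA := subsetP SA _ sS.
  apply: contrapT => no.
  have allS y : y \in A -> E s y -> y \in S.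
    by move=> yA sy; apply: contrapT => yS; apply: no; exists y => //;
      rewrite inE yA andbT; apply/negP.
  have dS' : dom (S :\ s).
    apply/'forall_implyP => x xA; have [->|xs] := eqVneq x s.
      have [y /setUP[yA|yC] sy] := hA s sA.
        apply/orP; right; apply/exists_inP; exists y => //.
        rewrite !inE allS // andbT; apply/orP; left.
        by apply: contraTneq sy => ->; rewrite iE.
      by apply/orP; right; apply/exists_inP; exists y => //; rewrite inE yC orbT.
    have [xS|[y /setUP[yS|yC] xy]] := domP S x dS xA.
    - by rewrite !inE xs xS.
    - have [ys|ys] := eqVneq y s; last first.
        by apply/orP; right; apply/exists_inP; exists y => //; rewrite !inE ys yS.
      by rewrite !inE xs allS // sE -ys.
    - by apply/orP; right; apply/exists_inP; exists y => //; rewrite inE yC orbT.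
  by have := minS _ dS' (subsetDl _ _) => /setP /(_ s); rewrite !inE eqxx sS.
have := cardsID S A; rewrite (setIidPr SA) => cA.
have [le|lt] := leqP (2 * #|S|) #|A|.
  by exists S; split=> // x; apply: domP.
exists (A :\: S); split; [exact: subsetDl | lia |] => x xA.
have [xS|xS] := boolP (x \in S); last by left; rewrite inE xS.
by have [y yAS xy] := out x xS; right; exists y => //; rewrite inE yAS.
Qed.

(** * Making a dominating set connected *)

Section ConnectedDomination.
Variables (P Y : {set V}) (c : V) (th : nat).
Hypothesis cP : c \in P.
Hypothesis connP : connected_on E P.
Hypothesis YP : Y \subset P.
Hypothesis cY : forall v, v \in P :\: Y -> v = c \/ E c v.
Hypothesis hY : forall y, y \in Y -> th <= #|nbrs E y :&: P|.

Definition dominating I := forall v, v \in P -> v \in I \/ exists2 u, u \in I & E u v.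

(* [c |: S] meets every component of the subgraph induced on [I]. *)
Definition spanned_by I S :=
  [/\ I \subset P, c \in I, dominating I
    & forall i, i \in I -> exists2 s, s \in c |: S & connect (induced E I) s i].

Lemma spanned_by_extend I S s s' (X : {set V}) : spanned_by I S -> s' \in S ->
  s \in c |: S -> s != s' -> X \subset P ->
  (forall x, x \in s' |: X -> connect (induced E (I :|: X)) s x) ->
  spanned_by (I :|: X) (S :\ s').
Proof.
move=> [IP cI dI rI] s'S sS ss' XP hX.
have mono := connect_induced_sub (E := E) (subsetUl I X).
have s's : s \in c |: S :\ s'.
  by move: sS; rewrite !inE ss' /= => /orP[->|->]; rewrite ?orbT.
split; [by rewrite subUset IP | by rewrite inE cI | |].
  by move=> v /dI[vI|[u uI uv]]; [left | right; exists u]; rewrite // inE ?vI ?uI.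
move=> i /setUP[/rI[t tS ti]|iX]; last first.
  by exists s => //; apply: hX; rewrite inE iX orbT.
have [tE|ts'] := eqVneq t s'; last first.
  exists t; last exact: mono ti.
  by move: tS; rewrite !inE ts' /= => /orP[->|->]; rewrite ?orbT.
exists s => //; apply: connect_trans (mono _ _ ti).
by rewrite tE; apply: hX; rewrite setU11.
Qed.

(** Five vertices with [th] neighbours each in [P] cannot have disjoint neighbourhoods there. A
    common neighbour of two representatives is added and one of them dropped, so [#|I| + #|S|] does
    not grow. *)
Lemma merge_common I S : #|P| < 5 * th -> spanned_by I S -> S \subset Y ->
  S \subset I -> exists I' S',
  [/\ spanned_by I' S', #|S'| <= 4 & #|I'| + #|S'| <= #|I| + #|S|].
Proof.
move=> hP; have [m] := ubnP #|S|; elim: m I S => // m IH I S Sm spI SY SI.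
have [le|lt] := leqP #|S| 4; first by exists I, S.
have [x xP] : exists2 x, x \in P & 1 < #|nbrs E x :&: S|.
  apply: contrapT => no.
  have : \sum_(x in P) #|nbrs E x :&: S| <= \sum_(x in P) 1.
    by apply: leq_sum => x xP; rewrite leqNgt; apply/negP => h; apply: no; exists x.
  rewrite sum1_card => h1.
  have := @leq_sum_nbrs P S th (fun w wS => hY (subsetP SY w wS)).
  have : 5 * th <= #|S| * th by rewrite leq_mul2r lt orbT.
  by lia.
case/card_gt1P => s [s' [/setIP[xs sS] /setIP[xs' s'S] ss']].
rewrite !in_nbrs in xs xs'.
have sI := subsetP SI _ sS; have s'I := subsetP SI _ s'S.
have sp' : spanned_by (I :|: [set x]) (S :\ s').
  apply: spanned_by_extend spI s'S _ ss' _ _.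
  - by rewrite inE sS orbT.
  - by rewrite sub1set.
  have sx : connect (induced E (I :|: [set x])) s x.
    by apply: connect1; rewrite /= !inE sI eqxx orbT sE xs.
  move=> z /set2P[]-> //; apply: connect_trans sx _.
  by apply: connect1; rewrite /= !inE s'I eqxx orbT xs'.
have cS : #|S :\ s'| < #|S| by rewrite [X in _ < X](cardsD1 s') s'S.
have [|||I' [S' [h1 h2 h3]]] := IH _ _ _ sp'.
- exact: leq_trans cS Sm.
- by apply: subset_trans SY; exact: subsetDl.
- by apply: subset_trans (subsetUl _ _); apply: subset_trans SI; exact: subsetDl.
exists I', S'; split=> //; apply: (leq_trans h3).
have cx : #|I :|: [set x]| <= #|I| + 1.
  by have := cardsUI I [set x]; rewrite cards1 => <-; exact: leq_addr.
by rewrite [#|S|](cardsD1 s') s'S addnA leq_add2r.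
Qed.

(** As [I] dominates [P] and [P] is connected, some component of [I] is within distance 3 of that of
    [c]. Two connectors join them and remove one representative. *)
Lemma merge_all I S : spanned_by I S -> exists I',
  [/\ c \in I', I' \subset P, dominating I', connected_on E I'
    & #|I'| <= #|I| + 2 * #|S|].
Proof.
have [m] := ubnP #|S|; elim: m I S => // m IH I S Sm spI.
have [IP cI dI rI] := spI.
have [all|] := boolP [forall i in I, connect (induced E I) c i].
  exists I; split=> //; last by rewrite leq_addr.
  by apply: (@connected_on_root _ _ _ c) => // x xI; move/'forall_implyP: all; exact.
rewrite negb_forall_in => /exists_inP[i iI ci].
pose K := [set x in I | connect (induced E I) c x].
(* The edge [x y] leaving the closed neighbourhood of the component [K] of [c] provides the
   connectors: [x] is in or next to [K], and [y] is in or next to another component. *)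
pose K1 := [set v in P | (v \in K) || [exists u in K, E u v]].
have cK : c \in K by rewrite inE cI connect0.
have closedK u v : u \in K -> v \in I -> E u v -> v \in K.
  rewrite !inE => /andP[uI cu] vI uv; rewrite vI; apply: connect_trans cu _.
  by apply: connect1; rewrite /= uI vI.
have iK1 : i \notin K1.
  rewrite inE (subsetP IP) //=; apply/negP => /orP[|/exists_inP[u uK ui]].
    by rewrite inE (negPf ci) andbF.
  by have := closedK _ _ uK iI ui; rewrite inE (negPf ci) andbF.
have cK1 : c \in K1 by rewrite inE cP cK.
have [x [y [/setIP[xP xK1] /setDP[yP yK1] xy]]] :=
  connected_on_exit connP cP (subsetP IP _ iI) cK1 iK1.
have yNK u : u \in K -> ~~ E u y.
  by move=> uK; apply: contraNN yK1 => uy; rewrite inE yP; apply/orP; right;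
    apply/exists_inP; exists u.
have yK : y \notin K by apply: contraNN yK1 => yK; rewrite inE yP yK.
pose X := [set x; y].
have XP : X \subset P by rewrite subUset !sub1set xP yP.
have mono := connect_induced_sub (E := E) (subsetUl I X).
have cx : connect (induced E (I :|: X)) c x.
  move: xK1; rewrite inE xP => /orP[|/exists_inP[u]]; rewrite inE.
    by move=> /andP[_ /mono].
  move=> /andP[uI /mono cu] ux; apply: connect_trans cu _.
  by apply: connect1; rewrite /= !inE uI ux eqxx orbT.
have cy : connect (induced E (I :|: X)) c y.
  by apply: connect_trans cx _; apply: connect1; rewrite /= !inE !eqxx xy !orbT.
have [w wI [cw wK]] : exists2 w, w \in I & connect (induced E (I :|: X)) c w /\ w
  \notin K.
  have [yI|[u uI uy]] := dI y yP; first by exists y.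
  exists u => //; split; last by apply/negP => /yNK; rewrite uy.
  by apply: connect_trans cy _; apply: connect1; rewrite /= !inE uI eqxx sE uy !orbT.
have [s sS sw] := rI w wI.
have sc : s != c by apply: contraNneq wK => sc; rewrite inE wI -sc.
have {}sS : s \in S by move: sS; rewrite !inE (negPf sc).
have cs : connect (induced E (I :|: X)) c s.
  apply: connect_trans cw _; rewrite (sym_connect_sym (induced_sym _ sE)).
  exact: mono.
have sp' : spanned_by (I :|: X) (S :\ s).
  apply: spanned_by_extend spI sS (setU11 _ _) _ XP _; first by rewrite eq_sym.
  by move=> z; rewrite !inE => /or3P[]/eqP-> .
have cS : #|S :\ s| < #|S| by rewrite [X in _ < X](cardsD1 s) sS.
have [|I' [h1 h2 h3 h4 h5]] := IH _ _ _ sp'; first exact: leq_trans cS Sm.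
exists I'; split=> //; apply: (leq_trans h5).
have cIX : #|I :|: X| <= #|I| + 2.
  have X2 : #|X| <= 2 by rewrite cards2; case: (_ != _).
  by apply: (leq_trans (leq_addr #|I :&: X| _)); rewrite cardsUI leq_add2l.
by rewrite [#|S|](cardsD1 s) sS mulnDr addnA leq_add2r.
Qed.

(** The greedy set [D] has at most [m] vertices and at most [m./2] representatives. [merge_common]
    preserves the bound [m.+1 + m./2] on [#|I| + #|S|] and leaves at most 4 representatives;
    [merge_all] adds two vertices for each, which gives the 5. *)
Lemma connected_domination a b m :
  b * #|P| <= b * th + a * #|P| -> #|P| < 5 * th -> #|P| * a ^ m < b ^ m ->
  exists I, [/\ c \in I, I \subset P, dominating I, connected_on E I
    & #|I| <= m + m./2 + 5].
Proof.
move=> hab hP hm.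
have P0 : 0 < #|P| by apply/card_gt0P; exists c.
have [D [DP Dm]] := @greedy_domination P Y th a b m P0 hY hab.
have YleP : #|Y| <= #|P| by exact: subset_leq_card.
move=> und.
have domD y : y \in Y -> exists2 x, x \in D & E y x.
  move=> yY; have [y0|] := eqVneq (nbrs E y :&: D) set0; last first.
    by case/set0Pn => x; rewrite inE in_nbrs => /andP[yx xD]; exists x.
  have : 0 < #|undominated Y D| by apply/card_gt0P; exists y; rewrite inE yY y0 eqxx.
  have : #|Y| * a ^ m <= #|P| * a ^ m.
    by rewrite leq_mul2r (subset_leq_card YP) orbT.
  by move: und hm; clear; nia.
(* Vertices of [D :\: Y] are [c] or its neighbours, so only [D :&: Y] needs representatives, and
   half of it suffices. *)
have [|S [SD S2 domS]] := @half_domination (D :&: Y) (D :\: Y).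
  by move=> x /setIP[xD /domD[y yD xy]]; exists y => //; rewrite setID.
have [SsD SY] : S \subset D /\ S \subset Y.
  by apply/andP; rewrite -subsetI.
have cDI x : x \in D :\: Y -> connect (induced E (c |: D)) c x.
  move=> /setDP[xD xY]; have [|->|cx] := cY (v := x); rewrite ?connect0 //.
    by rewrite inE xY (subsetP DP).
  by apply: connect1; rewrite /= !inE eqxx xD cx orbT.
have sp : spanned_by (c |: D) S.
  split; [by rewrite subUset sub1set cP | exact: setU11 | |].
    move=> v vP; have [vY|vY] := boolP (v \in Y).
      by have [x xD vx] := domD v vY; right; exists x; rewrite ?(sE x) // inE xD orbT.
    have [|->|cv] := cY (v := v); first by rewrite inE vY.
      by left; rewrite setU11.
    by right; exists c; rewrite ?setU11.
  move=> i /setU1P[->|iD]; first by exists c; rewrite ?setU11.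
  have [iY|iY] := boolP (i \in Y); last first.
    by exists c; rewrite ?setU11 // cDI // inE iY.
  have [|iS|[y /setUP[yS|yD] iy]] := domS i; first by rewrite inE iD iY.
  - by exists i; rewrite ?connect0 // inE iS orbT.
  - exists y; first by rewrite inE yS orbT.
    by apply: connect1; rewrite /= !inE (subsetP SsD) // iD sE iy !orbT.
  exists c; first exact: setU11.
  apply: connect_trans (cDI _ yD) _; apply: connect1.
  by case/setDP: yD => yD _; rewrite /= !inE yD iD sE iy !orbT.
have [|I1 [S1 [sp1 S14 c1]]] := merge_common hP sp SY.
  by apply: subset_trans SsD (subsetUr _ _).
have [I [h1 h2 h3 h4 h5]] := merge_all sp1.
exists I; split=> //; apply: (leq_trans h5).
have : #|c |: D| <= #|D|.+1 by rewrite cardsU1; case: (c \notin D).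
have : #|D :&: Y| <= #|D| by rewrite subset_leq_card // subsetIl.
by lia.
Qed.

End ConnectedDomination.
End Domination.

(** * Trees with prescribed inner vertices *)

Lemma subset_of_card (V : finType) (A : {set V}) (m : nat) : m <= #|A| ->
  exists2 X : {set V}, X \subset A & #|X| = m.
Proof.
move=> /card_geqP[s [us sm sA]]; exists [set x in s].
  by apply/subsetP => x; rewrite inE; exact: sA.
by rewrite cardsE; move/card_uniqP: us => ->.
Qed.

Section Frame.
Variables (V : finType) (E : rel V).
Hypothesis sE : symmetric E.
Hypothesis iE : irreflexive E.
Implicit Types (F I J R X : {set V}) (a : V -> V).

Definition attaches I a := forall v, v \notin I -> a v \in I /\ E (a v) v.

(** The vertices of [J] are served in turn: fewer than [#|J|] of them have already taken [k] leaves
    each, so [k] fresh neighbours outside [F] remain. Attachments inside [F] stay untouched. *)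
Lemma reserve_leaves k I F J a0 : I \subset F -> J \subset I ->
  attaches I a0 ->
  (forall i, i \in J -> k * #|J| <= #|nbrs E i :\: F|) ->
  exists a, [/\ attaches I a, {in F, a =1 a0}
    & forall i, i \in J -> k <= #|[set v | (v \notin F) && (a v == i)]|].
Proof.
move=> IF JI a0I hJ.
suff main : forall s : seq V, uniq s -> {subset s <= J} ->
    exists a R, [/\ [disjoint R & F], #|R| <= k * size s, attaches I a,
      forall v, v \notin R -> a v = a0 v
      & forall i, i \in s -> k <= #|[set v in R | a v == i]|].
  have [|a [R [RF Rk aI aR ak]]] := main (enum J) (enum_uniq _).
    by move=> i; rewrite mem_enum.
  exists a; split=> //.
    by move=> v vF; apply: aR; apply/negP => vR; move: (disjointFr RF vR); rewrite vF.
  move=> i iJ; have := ak i; rewrite mem_enum => /(_ iJ) /leq_trans; apply.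
  apply: subset_leq_card; apply/subsetP => v; rewrite !inE => /andP[vR ->].
  by rewrite (disjointFr RF).
elim=> [|i s IH] /=.
  by move=> _ _; exists a0, set0; rewrite cards0 disjoints_subset sub0set; split.
move=> /andP[iNs us] sJ.
have iJ : i \in J by apply: sJ; rewrite inE eqxx.
have [|a [R [RF Rk aI aR ak]]] := IH us.
  by move=> x xs; apply: sJ; rewrite inE xs orbT.
have ssJ : (size s).+1 <= #|J|.
  by rewrite cardE; apply: (@uniq_leq_size _ (i :: s)) => [|x /sJ];
    rewrite /= ?iNs ?mem_enum.
have [|X XN cX] := @subset_of_card _ ((nbrs E i :\: F) :\: R) k.
  have := cardsID R (nbrs E i :\: F).
  have : #|(nbrs E i :\: F) :&: R| <= #|R| by rewrite subset_leq_card // subsetIr.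
  have := hJ i iJ; have : k * (size s).+1 <= k * #|J| by rewrite leq_mul2l ssJ orbT.
  by lia.
have XP v : v \in X -> [/\ v \notin R, v \notin F & E i v].
  by move=> /(subsetP XN); rewrite !inE => /and3P[].
exists (fun v => if v \in X then i else a v), (R :|: X); split.
- move: RF; rewrite !disjoint_subset => /subsetP RF; apply/subsetP => v.
  by move=> /setUP[/RF//|/XP[]].
- by have := cardsUI R X; lia.
- move=> v vI; case: ifP => [/XP[_ _ iv]|_]; last exact: aI.
  by split=> //; exact: (subsetP JI).
- by move=> v; rewrite inE negb_or => /andP[vR /negPf ->]; exact: aR.
move=> j; rewrite inE => /orP[/eqP ->|js].
  rewrite -cX; apply: subset_leq_card; apply/subsetP => v vX.
  by rewrite !inE vX orbT eqxx.
apply: leq_trans (ak j js) _; apply: subset_leq_card; apply/subsetP => v.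
rewrite !inE => /andP[vR avj]; have vX : v \notin X by apply/negP => /XP[];
  rewrite vR.
by rewrite vR (negPf vX).
Qed.

Definition leaves I a i : {set V} := [set v | (v \notin I) && (a v == i)].

(* The neighbours of [q] in [I] all of whose links to the neighbourhood of [r]
   pass through [q]: a breadth-first tree rooted at [r] hangs them below [q]. *)
Definition forced_children I r q : {set V} :=
  [set u in I | [&& E q u, u != r, ~~ E r u
    & [forall w in I, E w u && E r w ==> (w == q)]]].

(** A breadth-first tree of [I] rooted at [r], with the remaining vertices hung as leaves by [a].
    The strict inequalities count the edge to the parent. *)
Lemma frame_tree I r a : connected_on E I -> r \in I -> attaches I a ->
  exists T, [/\ spanning_tree E T,
    forall v, v \notin I -> degree T v = 1,
    forall i, i \in I -> i != r -> #|leaves I a i| < degree T i,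
    #|leaves I a r| + #|nbrs E r :&: I| <= degree T r
    & forall q, q \in I -> E r q ->
        #|leaves I a q| + #|forced_children I r q| < degree T q].
Proof.
move=> cI rI aI; have [p0 [rk0 [p0P r0 r0' step]]] := bfs_parent cI rI.
pose par v := if v \in I then p0 v else a v.
pose rk v := if v \in I then rk0 v else (rk0 (a v)).+1.
have Epar v : v != r -> E v (par v).
  rewrite /par; case: ifP => [vI /(p0P v vI)[_ + _]|/negbT/aI[_ + _]]; by rewrite sE.
have rk_par v : v != r -> rk (par v) < rk v.
  rewrite /par /rk => vr; case: (boolP (v \in I)) => [vI|/aI[-> _]] //.
  by have [-> _ ->] := p0P v vI vr.
have V0 : 0 < #|V| by apply/card_gt0P; exists r.
have inI v : v \notin I -> v != r by apply: contraNneq => ->.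
have parI v : v != r -> par v \in I.
  by rewrite /par; case: ifP => [vI /(p0P v vI)[]|/negbT/aI[]].
have leavesS i : leaves I a i \subset children r par i.
  apply/subsetP => v; rewrite !inE => /andP[vI avi].
  by rewrite inI // /par (negPf vI).
have childU i (U : {set V}) : U \subset I -> U \subset children r par i ->
    #|leaves I a i| + #|U| <= #|children r par i|.
  move=> UI Uc; have := cardsUI (leaves I a i) U.
  have -> : leaves I a i :&: U = set0.
    by apply/setP => v; rewrite !inE;
      apply/negP => /andP[/andP[/negP vI _] /(subsetP UI)].
  rewrite cards0 addn0 => <-; apply: subset_leq_card.
  by rewrite subUset leavesS Uc.
have degE := parent_tree_degree rk_par.
exists (parent_tree r par); split.
- exact: parent_tree_spanning rk_par V0.
- move=> v vI; rewrite degE inI //; apply/eqP; rewrite eqn_add2l cards_eq0.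
  apply/eqP/setP => u; rewrite !inE; apply/negP => /andP[ur /eqP uv].
  by move: (parI u ur); rewrite uv (negPf vI).
- by move=> i iI ir; rewrite degE ir add1n ltnS; exact: subset_leq_card.
- rewrite degE eqxx add0n; apply: childU; first exact: subsetIr.
  apply/subsetP => u /setIP[]; rewrite in_nbrs => ru uI.
  have ur : u != r by apply: contraTneq ru => ->; rewrite iE.
  rewrite inE ur /par uI /=; apply/eqP; have [pI _ ru1] := p0P u uI ur.
  by apply: r0' => //; have := step r u rI uI ru; lia.
move=> q qI rq; have qr : q != r by apply: contraTneq rq => ->; rewrite iE.
rewrite degE qr add1n ltnS; apply: childU.
  by apply/subsetP => u; rewrite inE => /andP[].
apply/subsetP => u; rewrite !inE => /andP[uI /and4P[qu ur nru /'forall_implyP uni]].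
rewrite ur /par uI /=; have [pI pu u1] := p0P u uI ur.
(* The rank of [u] is at most 2 and its parent is not [r], so the parent has rank 1 and is adjacent
   to [r]; by [uni] it is [q]. *)
have rkq := step r q rI qI rq; have rku := step q u qI uI qu.
have pr : p0 u != r by apply: contraNneq nru => <-.
have [ppI ppp p1] := p0P _ pI pr.
have rp : E r (p0 u).
  by rewrite -(r0' _ ppI) //; lia.
by have := uni _ pI; rewrite pu rp.
Qed.

(** Vertices of [J] obtain their leaves greedily outside [F]; the root and the other inner vertices
    rely on leaves fixed beforehand in [F] and on edges forced in the breadth-first tree. *)
Lemma framed_2k_ST k I F J r a0 :
  connected_on E I -> r \in I -> I \subset F -> J \subset I -> attaches I a0 ->
  (forall i, i \in J -> k * #|J| <= #|nbrs E i :\: F|) ->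
  (forall i, i \in I -> i != r -> i \notin J ->
     E r i /\ k <= #|leaves I a0 i :&: F| + #|forced_children I r i|) ->
  (r \in J /\ nbrs E r :&: I != set0 \/
   k < #|leaves I a0 r :&: F| + #|nbrs E r :&: I|) ->
  has_2k_ST k E.
Proof.
move=> cI rI IF JI a0I hJ hI hr.
have [a [aI aF ak]] := reserve_leaves IF JI a0I hJ.
have [T [sT T1 TI Tr Tq]] := frame_tree cI rI aI.
have leavesF i : #|leaves I a0 i :&: F| <= #|leaves I a i|.
  apply: subset_leq_card; apply/subsetP => v; rewrite !inE => /andP[/andP[-> av] vF].
  by rewrite aF.
have leavesJ i : i \in J -> k <= #|leaves I a i|.
  move=> /ak /leq_trans; apply; apply: subset_leq_card; apply/subsetP => v.
  by rewrite !inE => /andP[vF ->]; rewrite (contraNN (subsetP IF v)).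
exists T => // v /andP[v2]; apply/negP; rewrite -ltnNge.
have vI : v \in I by apply: contraTT v2 => /T1 ->.
have [vr|vr] := eqVneq v r.
  rewrite vr; apply: leq_trans Tr; case: hr => [[rJ r1]|hr].
    rewrite -card_gt0 in r1.
    by have := leavesJ r rJ; lia.
  by have := leavesF r; lia.
have [vJ|vJ] := boolP (v \in J).
  by apply: leq_trans (TI v vI vr); rewrite ltnS leavesJ.
have [rv hv] := hI v vI vr vJ.
by apply: leq_trans (Tq v vI rv); rewrite ltnS; have := leavesF v; lia.
Qed.

End Frame.

(** * Blocking sets *)

Section Blocking.
Variables (V : finType) (E : rel V) (k : nat).
Hypothesis sE : symmetric E.
Implicit Types (U : {set V}).

Lemma degree_sub (e e' : rel V) v : subrel e e' -> degree e v <= degree e' v.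
Proof.
by move=> h; apply: subset_leq_card; apply/subsetP => u; rewrite !inE; exact: h.
Qed.

Lemma delete_vertices_sym U : symmetric (delete_vertices E U).
Proof. by move=> x y; rewrite /delete_vertices /= sE andbCA. Qed.

Lemma degree_delete_vertices U v : degree (delete_vertices E U) v <= degree E v.
Proof. by apply: degree_sub => x y /and3P[]. Qed.

Lemma degree_deleted U v : v \in U -> degree (delete_vertices E U) v = 0.
Proof.
by move=> vU; apply/eqP; rewrite cards_eq0; apply/eqP/setP => u;
  rewrite !inE /delete_vertices /= vU.
Qed.

(** Vertices of a blocking set have degree at most [k], hence degree at most 1 in the tree, and
    deleting leaves does not disconnect a tree. *)
Lemma ST_no_blocking_set : has_2k_ST k E -> ~ exists U, blocking_set k E U.
Proof.
move=> [T [[sT _] TE [_ cT] _] dT] [U [[x [y [xU yU nc]]] dU]]; apply: nc.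
have T1 v : v \in U -> degree T v <= 1.
  move=> /dU /andP[_ vk]; rewrite leqNgt; apply/negP => v2; apply: (dT v).
  by rewrite v2 (leq_trans (degree_sub v TE)).
have := connect_avoid sT T1 (cT x y) xU yU;
  apply: connect_sub => u v /and3P[uU vU uv].
by apply: connect1; rewrite /delete_vertices /= uU vU TE.
Qed.

Definition small : {set V} := [set v | degree E v <= k].

Hypothesis noblock : ~ exists U, blocking_set k E U.

Lemma non_blocking U x y : (forall u, u \in U -> 2 <= degree E u <= k) ->
  x \notin U -> y \notin U -> connect (delete_vertices E U) x y.
Proof.
move=> dU xU yU; apply: contrapT => nc; apply: noblock; exists U.
by split=> //; exists x, y.
Qed.

(** The small vertices of degree at least 2 do not form a cutset. Once they are deleted, the
    remaining small vertices have degree at most 1, and paths avoid them. *)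
Lemma connected_on_nonsmall : connected_on E (~: small).
Proof.
move=> x y; rewrite !inE -!ltnNge => xB yB.
pose U := [set u | 2 <= degree E u <= k].
have cU : connect (delete_vertices E U) x y.
  apply: non_blocking; rewrite ?inE; first by move=> u; rewrite inE.
    by rewrite negb_and -!ltnNge xB orbT.
  by rewrite negb_and -!ltnNge yB orbT.
have := @connect_avoid _ _ [pred v | v \in small] x y (@delete_vertices_sym U) _ cU.
rewrite /= !inE -!ltnNge xB yB => h.
apply: connect_sub (h _ isT isT) => [u v /and3P[uB vB /and3P[_ _ uv]]|v].
  by apply: connect1; rewrite /= !in_setC uB vB.
rewrite inE => vk; have [vU|] := boolP (v \in U); first by rewrite degree_deleted.
rewrite inE vk andbT -ltnNge ltnS => v1.
exact: leq_trans (degree_delete_vertices U v) v1.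
Qed.

(** The same argument with [p] kept: a path from [p] to [v] avoids all other small vertices, so its
    first edge leads to a vertex that is not small. *)
Lemma small_attached p v : p \in small -> v \notin small ->
  exists2 r, r \notin small & E r p.
Proof.
move=> pB vB; have pv : p != v by apply: contraNneq vB => <-.
pose U := [set u | 2 <= degree E u <= k] :\ p.
have cU : connect (delete_vertices E U) p v.
  apply: non_blocking; first by move=> u; rewrite !inE => /andP[].
    by rewrite !inE eqxx.
  by move: vB; rewrite !inE -!ltnNge => vk; rewrite !negb_and -!ltnNge vk !orbT.
have /connect_exit : connect [rel u w | [&& ~~ ((u \in small) && (u != p)),
    ~~ ((w \in small) && (w != p)) & delete_vertices E U u w]] p v.
  apply: (@connect_avoid _ _ [pred w | (w \in small) && (w != p)]) => //=.
  - exact: delete_vertices_sym.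
  - move=> w /andP[]; rewrite inE => wk wp.
    have [wU|] := boolP (w \in U); first by rewrite degree_deleted.
    rewrite !inE wp wk andbT /= -ltnNge ltnS => w1.
    exact: leq_trans (degree_delete_vertices U w) w1.
  - by rewrite eqxx andbF.
  - by rewrite (negPf vB).
move=> /(_ [set p]); rewrite set11 inE eq_sym => /(_ isT pv).
move=> [u [w [/set1P -> wp /and3P[_ ws /and3P[_ _ pw]]]]].
rewrite inE in wp; rewrite wp andbT in ws.
by exists w => //; rewrite sE.
Qed.

End Blocking.

(** * Construction of the spanning tree *)

Section Construction.
Variables (V : finType) (E : rel V) (k : nat).
Hypothesis sE : symmetric E.
Hypothesis iE : irreflexive E.
Hypothesis k2 : 2 <= k.
Notation n := #|V|.
Hypothesis hn : large_order k n.
Hypothesis ore : forall u v, u != v -> ~~ E u v ->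
  n + 2 * k <= 2 * (degree E u + degree E v) + 2.
Hypothesis noblock : ~ exists U, blocking_set k E U.
Implicit Types (A C D F I J M P Q S T U X Y : {set V}).

(** * Small and poor vertices *)

Notation B := (small E k).
Notation rho := (n %/ 10).
Definition poor : {set V} := [set v | degree E v < rho].
Notation Q := poor.

Lemma order_ge : 64 * k * k <= n.
Proof.
have [j kj] : exists j, k = j.+2 by exists (k - 2); lia.
by move: hn; rewrite /large_order kj /= -mulnn; clear; nia.
Qed.

Lemma rho_gt : 6 * k * k <= rho.
Proof. by have := order_ge; lia. Qed.

Lemma rho_gtk : k < rho.
Proof. by have := rho_gt; nia. Qed.

Lemma card_setC_add A : #|~: A| + #|A| = n.
Proof. by rewrite addnC cardsC. Qed.

Lemma nbrs_setI_ge y P X : nbrs E y \subset P :|: X ->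
  degree E y <= #|nbrs E y :&: P| + #|X|.
Proof.
move=> h; apply: leq_trans (_ : #|(nbrs E y :&: P) :|: X| <= _); last first.
  by have := cardsUI (nbrs E y :&: P) X; lia.
apply: subset_leq_card; apply/subsetP => x; rewrite inE => xy.
by have := subsetP h x; rewrite !inE xy => /(_ isT) /orP[]->; rewrite ?orbT.
Qed.

Lemma small_sub_poor : B \subset Q.
Proof. by apply/subsetP => v; rewrite !inE => h; exact: leq_ltn_trans h rho_gtk. Qed.

Lemma poor_clique u v : u \in Q -> v \in Q -> u != v -> E u v.
Proof.
rewrite !inE => uQ vQ uv; apply: contrapT => /negP nuv; have := ore uv nuv.
by lia.
Qed.

Lemma card_poor q : q \in Q -> #|Q| <= (degree E q).+1.
Proof.
move=> qQ; rewrite (cardsD1 q) qQ add1n ltnS; apply: subset_leq_card.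
by apply/subsetP => v /setD1P[vq vQ]; rewrite inE poor_clique // eq_sym.
Qed.

Lemma card_poor_le : #|Q| <= rho.
Proof.
have [->|[q qQ]] := set_0Vmem Q; first by rewrite cards0.
by apply: leq_trans (card_poor qQ) _; move: qQ; rewrite inE.
Qed.

Lemma card_small_le : #|B| <= k.+1.
Proof.
have [->|[q qB]] := set_0Vmem B; first by rewrite cards0.
apply: leq_trans (subset_leq_card small_sub_poor) _.
apply: leq_trans (card_poor (subsetP small_sub_poor _ qB)) _.
by move: qB; rewrite inE.
Qed.

Lemma attachment I :
  (forall v, v \notin I -> exists2 u, u \in I & E u v) ->
  exists g, attaches E I g.
Proof.
move=> h; suff [g gP] : exists g, forall v, v \notin I -> g v \in I /\ E (g v) v by
  exists g.
apply: (@fin_all_exists _ (fun=> V) (fun v u => v \notin I -> u \in I /\ E u v)) => v.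
have [vI|vI] := boolP (v \in I); first by exists v.
by have [u uI uv] := h v vI; exists u.
Qed.

(** A connected set dominating [G - B] is enlarged by one neighbour of each small vertex. Every
    inner vertex then has degree at least that of [c], enough to serve all of them greedily. *)
Lemma ST_centered c th a b m :
  c \notin B -> (forall v, v \notin B -> degree E c <= degree E v) ->
  (forall y, y \notin B -> y != c -> ~~ E c y -> th + #|B| <= degree E y) ->
  b * (n - #|B|) <= b * th + a * (n - #|B|) -> n - #|B| < 5 * th ->
  n * a ^ m < b ^ m -> k.+1 * (m + m./2 + k + 6) <= degree E c ->
  has_2k_ST k E.
Proof.
move=> cB cmin hth hab hP hm hc.
have cardP : #|~: B| = n - #|B| by have := card_setC_add B; lia.
pose P := ~: B; pose Y := P :\: (c |: nbrs E c).
have cP : c \in P by rewrite inE.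
have [|||||||I [cI IP dI connI cardI]] :=
  @connected_domination _ E sE iE P Y c th cP _ _ _ _ a b m.
- exact: connected_on_nonsmall.
- exact: subsetDl.
- move=> v /setDP[vP]; rewrite in_setD vP andbT negbK in_setU1 in_nbrs.
  by move=> /orP[/eqP|]; [left|right].
- move=> y /setDP[]; rewrite in_setC in_setU1 in_nbrs negb_or => yB /andP[yc cy].
  rewrite -(leq_add2r #|B|); apply: leq_trans (hth y yB yc cy) _; apply: nbrs_setI_ge.
  by apply/subsetP => z _; rewrite in_setU in_setC orNb.
- by rewrite cardP.
- by rewrite cardP.
- by rewrite cardP; apply: leq_ltn_trans hm; rewrite leq_mul2r leq_subr orbT.
have [r rP] : exists r, forall p, p \in B -> r p \notin B /\ E (r p) p.
  apply: (@fin_all_exists _ (fun=> V) (fun p u => p \in B -> u \notin B /\ E u p)) =>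
    p.
  have [pB|pB] := boolP (p \in B); last by exists p.
  by have [z zB zp] := small_attached sE noblock pB cB; exists z.
pose I' := I :|: [set r p | p in B].
have cI' : c \in I' by rewrite inE cI.
have I'P v : v \in I' -> v \notin B.
  by move=> /setUP[/(subsetP IP)|/imsetP[p pB ->]]; [rewrite inE | case: (rP p pB)].
have connI' : connected_on E I'.
  apply: connected_on_dominated => // x /imsetP[p pB ->] rI.
  by have [|rI'|//] := dI (r p); [rewrite inE; case: (rP p pB) | rewrite rI' in rI].
have cardI' : #|I'| <= m + m./2 + k + 6.
  apply: leq_trans (leq_card_setU _ _).1 _.
  have -> : m + m./2 + k + 6 = (m + m./2 + 5) + k.+1 by lia.
  by apply: leq_add => //; apply: leq_trans (leq_imset_card _ _) card_small_le.
have [|g gI] := @attachment I'.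
  move=> v vI'; have [vB|vB] := boolP (v \in B).
    by exists (r v); [rewrite inE imset_f ?orbT | case: (rP v vB)].
  have [|vI|[u uI uv]] := dI v; first by rewrite inE.
    by rewrite inE vI in vI'.
  by exists u => //; rewrite inE uI.
(* The root needs an inner neighbour besides its [k] leaves. Without one, [I'] is [[set c]] and the
   tree is a star. *)
have [n0|n0] := eqVneq (nbrs E c :&: I') set0; last first.
  apply: (framed_2k_ST sE iE connI' cI' (subxx _) (subxx _) gI); last by left.
    move=> i iI'; have := cmin i (I'P i iI').
    have := cardsID I' (nbrs E i).
    have : #|nbrs E i :&: I'| <= #|I'| by rewrite subset_leq_card // subsetIr.
    have : k.+1 * #|I'| <= degree E c by apply: leq_trans hc;
      rewrite leq_mul2l cardI' orbT.
    rewrite /degree -/(nbrs E i); lia.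
  by move=> i -> _.
have I'c : I' = [set c].
  apply/setP => x; rewrite inE; apply/idP/eqP => [xI'|->//]; apply: contrapT => xc.
  have [||u [w [/setIP[uI' /set1P uc] /setDP[wI' _] uw]]] :=
    @connected_on_exit _ E I' [set c] c x connI' cI' xI'.
  - exact: set11.
  - by rewrite inE; apply/eqP.
  by have := in_set0 w; rewrite -n0 in_setI wI' andbT in_nbrs -uc uw.
apply: (@framed_2k_ST _ E sE iE k I' setT set0 c g connI' cI') => //.
- exact: sub0set.
- by move=> i; rewrite inE.
- by move=> i; rewrite I'c => /set1P->; rewrite eqxx.
right; have -> : leaves I' g c :&: setT = ~: [set c].
  apply/setP => v; rewrite setIT in_setC in_set I'c in_set1;
    have [//|vc] := eqVneq v c.
  have [|+ _] := gI v; first by rewrite I'c inE.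
  by rewrite I'c => /set1P ->; rewrite eqxx.
have := card_setC_add [set c]; rewrite cards1.
by have := order_ge; nia.
Qed.

(** The centre is a vertex of least degree outside [B], and the degree sum condition bounds below
    the degrees of its non-neighbours. Two ranges of its degree need different greedy ratios. *)
Lemma ST_poor_small : Q \subset B -> has_2k_ST k E.
Proof.
move=> QB.
have [c0 c0B] : exists c, c \in ~: B.
  apply/card_gt0P; have := card_setC_add B; have := card_small_le.
  by have := order_ge; nia.
have [c cB cmin'] := @arg_minnP _ c0 (mem (~: B)) (degree E) c0B.
have {cB} cB : c \notin B by rewrite -in_setC.
have cmin v : v \notin B -> degree E c <= degree E v.
  by rewrite -in_setC; exact: cmin'.
have rich : rho <= degree E c.
  by have := contra (subsetP QB c) cB; rewrite inE -leqNgt.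
have bk := card_small_le; have on := order_ge.
(* If the centre has degree at least [n / 7], a non-neighbour has at least the same degree, hence at
   least half of the degree sum. *)
have [big|sm] := leqP n (7 * degree E c).
  have [m hm1 hm2] := large_order_quarters k2 hn.
  apply: (@ST_centered c ((n + 2 * k - 2) %/ 4 - #|B|) 19 25 m) => //; [|nia|nia|lia].
  move=> y yB yc cy; have := cmin y yB.
  by have := ore (v := y) (u := c); rewrite eq_sym => /(_ yc cy); nia.
(* Otherwise a non-neighbour has degree at least about [5 * n / 14], more than a third of the
   graph. *)
have [m hm1 hm2] := large_order_thirds k2 hn.
apply: (@ST_centered c ((n + 2 * k - 2) %/ 2 - degree E c - #|B|) 2 3 m) => //;
  [|nia|nia|lia].
move=> y yB yc cy.
by have := ore (v := y) (u := c); rewrite eq_sym => /(_ yc cy); nia.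
Qed.

(* Only the root [q] is poor; its own neighbours supply its [k.+1] children. *)
Lemma ST_one_poor q : q \in Q -> q \notin B -> connected_on E (q |: ~: Q) ->
  has_2k_ST k E.
Proof.
move=> qQ qB connP; pose P := q |: ~: Q; pose Y := P :\: (q |: nbrs E q).
(* The summand 2 comes from [degree E q <= rho - 1] and from [q] itself being in [P], so that only
   [#|Q| - 1] poor vertices are lost. *)
pose th := (n + 2 * k - 2) %/ 2 + 2 - (rho + #|Q|).
have Qrho := card_poor_le; have on := order_ge.
have dq : degree E q < rho by move: qQ; rewrite inE.
have kq : k < degree E q by move: qB; rewrite inE -ltnNge.
have cardP : #|P| = (n - #|Q|).+1.
  rewrite cardsU1 in_setC negbK qQ add1n.
  by have := card_setC_add Q; move: #|~: Q| #|Q| => x y; lia.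
have cardPth : #|P| <= 3 * th.
  by rewrite cardP /th; move: k2 Qrho; move: #|Q| => x; lia.
have P0 : 0 < #|P| by rewrite cardP.
have [m hm1 hm2] := large_order_thirds k2 hn.
have [|||||||I [qI IP dI connI cardI]] :=
  @connected_domination _ E sE iE P Y q th _ connP _ _ _ 2 3 m.
- exact: setU11.
- exact: subsetDl.
- move=> v /setDP[vP]; rewrite in_setD vP andbT negbK in_setU1 in_nbrs.
  by move=> /orP[/eqP|]; [left|right].
- move=> y /setDP[]; rewrite !in_setU1 in_setC in_nbrs negb_or => + /andP[yq qy].
  rewrite (negPf yq) /= => yQ.
  have : degree E y <= #|nbrs E y :&: P| + #|Q :\ q|.
    apply: nbrs_setI_ge; apply/subsetP => z _;
      rewrite in_setU in_setU1 in_setC in_setD1.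
    by case: (z == q); case: (z \in Q).
  have := ore (u := q) (v := y); rewrite eq_sym => /(_ yq qy).
  have := cardsD1 q Q; rewrite qQ /th; move: dq.
  by move: #|_ :&: _| #|_ :\ _| #|Q| (degree E y) (degree E q) => ? ? ? ? ?; lia.
- by move: cardPth; clear; lia.
- by move: cardPth P0; clear; lia.
- apply: leq_ltn_trans hm1; rewrite leq_mul2r; apply/orP; right.
  by rewrite cardP; have : 0 < #|Q| by [apply/card_gt0P; exists q]; 
     have := card_setC_add Q; move: #|Q| #|~: Q| => ? ?; lia.
have Irich i : i \in I -> i != q -> rho <= degree E i.
  move=> /(subsetP IP); rewrite in_setU1 in_setC => /orP[->//|].
  by rewrite inE -leqNgt.
(* The root keeps its [t] neighbours in [I]; the [k.+1 - t] leaves still missing are reserved in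
   [S], which is possible because [q] is not small. *)
pose t := #|nbrs E q :&: I|.
have [|S SN cardS] := @subset_of_card _ (nbrs E q :\: I) (k.+1 - t).
  have := cardsID I (nbrs E q); rewrite -/t -/(degree E q).
  by move: kq; rewrite /degree -/(nbrs E q); lia.
have [|g gI] := @attachment I.
  move=> v vI; have [vQ|vQ] := boolP (v \in Q).
    by exists q => //; apply: poor_clique => //; apply: contraNneq vI => <-.
  have [|vI'|//] := dI v; first by rewrite in_setU1 in_setC vQ orbT.
  by rewrite vI' in vI.
pose a0 v := if v \in S then q else g v.
have SP v : v \in S -> v \notin I /\ E q v.
  by move=> /(subsetP SN); rewrite in_setD in_nbrs => /andP[].
apply: (@framed_2k_ST _ E sE iE k I (I :|: S) (I :\ q) q a0 connI qI).
- exact: subsetUl.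
- exact: subsetDl.
- by move=> v vI; rewrite /a0; case: ifP => [/SP[]//|_]; exact: gI.
- move=> i /setD1P[iq iI]; have := Irich i iI iq.
  have := cardsID (I :|: S) (nbrs E i); rewrite -/(degree E i).
  have : #|nbrs E i :&: (I :|: S)| <= #|I| + #|S|.
    apply: leq_trans (subset_leq_card (subsetIr _ _)) _.
    exact: (leq_card_setU _ _).1.
  have := cardsD1 q I; rewrite qI.
  have : #|S| <= k.+1 by rewrite cardS leq_subr.
  have : k.+1 * #|I| <= k.+1 * (m + m./2 + 5) by rewrite leq_mul2l cardI orbT.
  rewrite /degree -/(nbrs E i); move: hm2 cardI; clear.
  move: #|nbrs E i| #|_ :&: _| #|_ :\: _| #|_ :\ _| #|I| #|S| (n %/ 10) => ? ? ? ? ?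
    ? ? ? ?.
  by nia.
- by move=> i iI iq; rewrite in_setD1 iI iq.
right; rewrite -/t.
have : #|S| <= #|leaves I a0 q :&: (I :|: S)|.
  apply: subset_leq_card; apply/subsetP => v vS; have [vI _] := SP v vS.
  by rewrite in_setI in_setU vS orbT andbT in_set vI /a0 vS eqxx.
by rewrite cardS; lia.
Qed.

(* Two poor vertices: [q1] is the root and [q2] its child, each serving the
   side of the graph that the other one does not reach. *)
Lemma ST_two_poor q1 q2 C1 C2 : q1 \in Q -> q2 \in Q -> q1 != q2 ->
  C1 :|: C2 = ~: Q -> [disjoint C1 & C2] ->
  (forall u v, u \in C1 -> v \in C2 -> ~~ E u v) ->
  (forall v, v \in C2 -> ~~ E q1 v) -> (forall v, v \in C1 -> ~~ E q2 v) ->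
  connected_on E ([set q1; q2] :|: ~: Q) ->
  (k - #|nbrs E q1 :&: C1|) + (k - #|nbrs E q2 :&: C2|) + 2 <= #|Q| ->
  has_2k_ST k E.
Proof.
move=> q1Q q2Q q12 C12 disC noC q1C2 q2C1 connP count.
pose P := [set q1; q2] :|: ~: Q.
pose th := (n + 2 * k - 2) %/ 2 + 3 - (rho + #|Q|).
have Qrho := card_poor_le; have on := order_ge.
have dq q : q \in Q -> degree E q < rho by rewrite inE.
have Eq12 : E q1 q2 by exact: poor_clique.
have CQ v : v \in C1 :|: C2 -> v \notin Q by rewrite C12 in_setC.
have cardQ : #|Q| = #|Q :\: [set q1; q2]| + 2.
  rewrite -(cardsID [set q1; q2] Q) addnC; congr (_ + _).
  have -> : Q :&: [set q1; q2] = [set q1; q2].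
    by apply/setIidPr/subsetP => v /set2P[]->.
  by rewrite cards2 q12.
have cardP : #|P| = n - #|Q| + 2.
  rewrite cardsU cards2 q12.
  have -> : [set q1; q2] :&: ~: Q = set0.
    by apply/setP => v; rewrite in_setI in_set2 in_setC in_set0;
      apply/negP => /andP[/orP[]/eqP->]; rewrite ?q1Q ?q2Q.
  by have := card_setC_add Q; rewrite cards0; move: #|~: Q| #|Q| => x y; lia.
have cardPth : #|P| <= 3 * th.
  by rewrite cardP /th; move: k2 Qrho; move: #|Q| => x; lia.
have P0 : 0 < #|P| by rewrite cardP addn2.
have [m hm1 hm2] := large_order_thirds k2 hn.
have cntP y q : y \in C1 :|: C2 -> q \in Q -> ~~ E q y -> th <= #|nbrs E y :&: P|.
  move=> yC qQ qy; have yQ := CQ y yC.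
  have : degree E y <= #|nbrs E y :&: P| + #|Q :\: [set q1; q2]|.
    apply: nbrs_setI_ge; apply/subsetP => z _;
      rewrite in_setU [z \in P]in_setU in_setC in_setD !in_set2.
    by case: (z == q1); case: (z == q2); case: (z \in Q).
  have yq : q != y by apply: contraNneq yQ => <-.
  have := ore yq qy; have := dq q qQ; have := cardQ; rewrite /th; clear.
  by move: #|_ :&: _| #|_ :\: _| #|Q| (degree E y) (degree E q) => ? ? ? ? ?; lia.
(* Every rich vertex misses [q1] or [q2], so the degree sum condition applies to all of them; the
   vertices of [P] outside [~: Q] are [q1] and its neighbour [q2]. *)
have [|||||||I0 [q1I0 I0P dI0 connI0 cardI0]] :=
  @connected_domination _ E sE iE P (~: Q) q1 th _ connP _ _ _ 2 3 m.
- by rewrite in_setU in_set2 eqxx.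
- exact: subsetUr.
- move=> v /setDP[]; rewrite in_setU in_set2 => + /negPf vQ; rewrite vQ orbF.
  by move=> /orP[]/eqP ->; [left | right].
- move=> y; rewrite -C12 => yC; have /setUP[yC1|yC2] := yC.
    by apply: (@cntP y q2 yC) => //; exact: q2C1.
  by apply: (@cntP y q1 yC) => //; exact: q1C2.
- by move: cardPth; clear; lia.
- by move: cardPth P0; clear; lia.
- apply: leq_ltn_trans hm1; rewrite leq_mul2r; apply/orP; right.
  have := max_card (mem Q); rewrite cardP cardQ.
  by move: #|_ :\: _| => x; lia.
pose I := I0 :|: [set q2].
have q1I : q1 \in I by rewrite in_setU q1I0.
have q2I : q2 \in I by rewrite in_setU set11 orbT.
have IP v : v \in I -> [\/ v = q1, v = q2 | v \in C1 :|: C2].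
  rewrite C12 => /setUP[/(subsetP I0P)/setUP[/set2P[]->|]|/set1P->];
    by [constructor 1|constructor 2|constructor 3].
have connI : connected_on E I.
  by apply: connected_on_dominated => // x /set1P-> _; exists q1.
have cardI : #|I| <= m + m./2 + 6.
  apply: leq_trans (leq_card_setU _ _).1 _; rewrite cards1.
  by move: cardI0; clear; lia.
(* [U1] and [U2] take up to [k] neighbours on the own side; disjoint sets [T1] and [T2] of other
   poor vertices make up the shortfall. Those outside [I] become reserved leaves, the others tree
   neighbours. The 2 in [count] stands for [q1] and [q2]. *)
pose N1 := nbrs E q1 :&: C1; pose N2 := nbrs E q2 :&: C2.
pose Q' := Q :\: [set q1; q2].
have cardQ' : (k - #|N1|) + (k - #|N2|) <= #|Q'|.
  by move: count; rewrite cardQ leq_add2r.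
have [|T1 T1Q cardT1] := @subset_of_card _ Q' (k - #|N1|).
  exact: leq_trans (leq_addr _ _) cardQ'.
have [|T2 T2Q cardT2] := @subset_of_card _ (Q' :\: T1) (k - #|N2|).
  by have := cardsID T1 Q'; rewrite (setIidPr T1Q) cardT1; move: cardQ'; clear; lia.
have [|U1 U1N cardU1] := @subset_of_card _ N1 (minn k #|N1|); first exact: geq_minr.
have [|U2 U2N cardU2] := @subset_of_card _ N2 (minn k #|N2|); first exact: geq_minr.
have Q'P v : v \in Q' -> [/\ v \in Q, v \notin I, E q1 v & E q2 v].
  move=> /setDP[vQ]; rewrite in_set2 negb_or => /andP[v1 v2]; split=> //.
  - apply/negP => /IP[vE|vE|/CQ]; rewrite ?vE ?vQ ?eqxx // in v1 v2 *.
  - by apply: poor_clique; rewrite // eq_sym.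
  - by apply: poor_clique; rewrite // eq_sym.
have T1P v : v \in T1 -> v \in Q' by exact: (subsetP T1Q).
have T2P v : v \in T2 -> v \in Q' /\ v \notin T1.
  by move=> /(subsetP T2Q) /setDP.
have U1P v : v \in U1 -> v \in C1 /\ E q1 v.
  by move=> /(subsetP U1N) /setIP[]; rewrite in_nbrs.
have U2P v : v \in U2 -> v \in C2 /\ E q2 v.
  by move=> /(subsetP U2N) /setIP[]; rewrite in_nbrs.
pose S1 := T1 :|: (U1 :\: I); pose S2 := T2 :|: (U2 :\: I).
have S1P v : v \in S1 -> v \notin I /\ E q1 v.
  by move=> /setUP[/T1P/Q'P[]//|/setDP[/U1P[]]].
have S2P v : v \in S2 -> [/\ v \notin I, E q2 v & v \notin S1].
  move=> /setUP[/T2P[vQ' vT1]|/setDP[/U2P[vC2 v2] vI]].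
    have [vQ vI v1 v2] := Q'P v vQ'; split=> //;
      apply/negP => /setUP[|/setDP[/U1P[vC1 _] _]].
      by rewrite (negPf vT1).
    by have := CQ v; rewrite in_setU vC1 vQ => /(_ isT).
  split=> //; apply/negP => /setUP[/T1P/Q'P[vQ _ _ _]|/setDP[/U1P[vC1 _] _]].
    by have := CQ v; rewrite in_setU vC2 orbT vQ => /(_ isT).
  by have := disjointFr disC vC1; rewrite vC2.
have cardS1 : #|S1| + #|U1 :&: I| = k.
  rewrite cardsU (_ : T1 :&: _ = set0) ?cards0 ?subn0.
    have := cardsID I U1; rewrite cardT1 cardU1 /minn; clear.
    by move: #|_ :&: _| #|_ :\: _| #|N1| => ? ? ?; case: ifP; lia.
  apply/setP => v; rewrite in_set0;
    apply/negP => /setIP[/T1P/Q'P[vQ _ _ _] /setDP[/U1P[vC1 _] _]].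
  by have := CQ v; rewrite in_setU vC1 vQ => /(_ isT).
have cardS2 : #|S2| + #|U2 :&: I| = k.
  rewrite cardsU (_ : T2 :&: _ = set0) ?cards0 ?subn0.
    have := cardsID I U2; rewrite cardT2 cardU2 /minn; clear.
    by move: #|_ :&: _| #|_ :\: _| #|N2| => ? ? ?; case: ifP; lia.
  apply/setP => v; rewrite in_set0;
    apply/negP => /setIP[/T2P[/Q'P[vQ _ _ _] _] /setDP[/U2P[vC2 _] _]].
  by have := CQ v; rewrite in_setU vC2 orbT vQ => /(_ isT).
have [|g gI] := @attachment I.
  move=> v vI; have [vQ|vQ] := boolP (v \in Q).
    by exists q1 => //; apply: poor_clique => //; apply: contraNneq vI => <-.
  have [|vI0|[u uI0 uv]] := dI0 v; first by rewrite in_setU in_setC vQ orbT.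
    by rewrite in_setU vI0 in vI.
  by exists u => //; rewrite in_setU uI0.
pose a0 v := if v \in S1 then q1 else if v \in S2 then q2 else g v.
pose F := I :|: (S1 :|: S2).
apply: (@framed_2k_ST _ E sE iE k I F (I :\: [set q1; q2]) q1 a0 connI q1I).
- exact: subsetUl.
- exact: subsetDl.
- move=> v vI; rewrite /a0; case: ifP => [/S1P[]//|_].
  by case: ifP => [/S2P[]//|_]; exact: gI.
- move=> i /setDP[iI]; rewrite in_set2 negb_or => /andP[i1 i2].
  have : rho <= degree E i.
    have [iE'|iE'|/CQ] := IP i iI; first by rewrite iE' eqxx in i1.
      by rewrite iE' eqxx in i2.
    by rewrite inE -leqNgt.
  have := cardsID F (nbrs E i).
  have : #|nbrs E i :&: F| <= #|I| + (#|S1| + #|S2|).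
    apply: leq_trans (subset_leq_card (subsetIr _ _)) _.
    apply: leq_trans (leq_card_setU _ _).1 _; rewrite leq_add2l.
    exact: (leq_card_setU _ _).1.
  have : #|I :\: [set q1; q2]| <= #|I| by apply: subset_leq_card; exact: subsetDl.
  have : #|S1| <= k by rewrite -cardS1 leq_addr.
  have : #|S2| <= k by rewrite -cardS2 leq_addr.
  have : k.+1 * #|I| <= k.+1 * (m + m./2 + 6) by rewrite leq_mul2l cardI orbT.
  rewrite /degree -/(nbrs E i); move: k2 hm2; clear.
  move: #|nbrs E i| #|_ :&: _| #|_ :\: F| #|_ :\: _| #|I| #|S1| #|S2| (n %/ 10) => ?
    ? ? ? ? ? ? ?.
  by nia.
- move=> i iI i1; rewrite in_setD iI andbT negbK in_set2 (negPf i1) => /eqP ->;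
    split=> //.
  have le1 : #|S2| <= #|leaves I a0 q2 :&: F|.
    apply: subset_leq_card; apply/subsetP => v vS; have [vI _ vS1] := S2P v vS.
    by rewrite in_setI [v \in F]in_setU [v \in S1 :|: S2]in_setU vS !orbT andbT
      in_set vI /a0 (negPf vS1) vS eqxx.
  (* No vertex of [C1] reaches [C2] and no vertex of [C2] is adjacent to [q1], so [q2] is the only
     link in [I] from [q1] to such a vertex. *)
  have le2 : #|U2 :&: I| <= #|forced_children E I q1 q2|.
    apply: subset_leq_card; apply/subsetP => v /setIP[/U2P[vC2 v2] vI].
    have v1 : v != q1.
      by apply/negP => /eqP vE; have := CQ v;
        rewrite in_setU vC2 orbT vE q1Q => /(_ isT).
    rewrite in_set vI v2 v1 q1C2 //=; apply/'forall_implyP => w wI.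
    apply/implyP => /andP[wv q1w]; have [wE|->//|/setUP[wC1|wC2]] := IP w wI.
    - by rewrite wE iE in q1w.
    - by have := noC w v wC1 vC2; rewrite wv.
    - by have := q1C2 w wC2; rewrite q1w.
  by rewrite -cardS2 leq_add.
right.
have le1 : #|S1| <= #|leaves I a0 q1 :&: F|.
  apply: subset_leq_card; apply/subsetP => v vS; have [vI _] := S1P v vS.
  by rewrite in_setI [v \in F]in_setU [v \in S1 :|: S2]in_setU vS !orbT andbT in_set
    vI /a0 vS eqxx.
(* The child [q2] is the extra neighbour that lifts the degree of the root to [k.+1]. *)
have le2 : #|U1 :&: I| < #|nbrs E q1 :&: I|.
  have q2N : q2 \in nbrs E q1 :&: I by rewrite in_setI in_nbrs Eq12.
  rewrite [X in _ < X](cardsD1 q2) q2N add1n ltnS.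
  apply: subset_leq_card; apply/subsetP => v /setIP[/U1P[vC1 v1] vI].
  rewrite in_setD1 in_setI in_nbrs v1 vI !andbT.
  by apply/negP => /eqP vE; have := CQ v; rewrite in_setU vC1 vE q2Q => /(_ isT).
by rewrite -cardS1 -addnS leq_add.
Qed.

(** * Components of the rich part *)

Notation rich := (~: Q).

Definition comp v : {set V} := [set u | connect (induced E rich) v u].

Lemma comp_self v : v \in comp v.
Proof. by rewrite inE connect0. Qed.

Lemma comp_step v u w : u \in comp v -> u \in rich -> w \in rich -> E u w ->
  w \in comp v.
Proof.
rewrite !in_set => vu uR wR uw; apply: connect_trans vu _.
by apply: connect1; rewrite /= !in_setC !in_set uR wR.
Qed.

Lemma comp_rich v : v \in rich -> comp v \subset rich.
Proof.
move=> vR; apply/subsetP => u; rewrite in_set => vu; apply: contrapT => /negP uR.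
by have [x [y [_ yR /and3P[_ yR' _]]]] := connect_exit vu vR uR; rewrite yR' in yR.
Qed.

Lemma comp_connected v : v \in rich -> connected_on E (comp v).
Proof.
move=> vR; apply: (@connected_on_root _ _ _ v) => // u; rewrite in_set => vu.
apply: contrapT => /negP nu.
have [||x [y []]] := @connect_exit _ _ [set w | connect (induced E (comp v)) v w] _ _
  vu.
- by rewrite in_set connect0.
- by rewrite in_set.
rewrite !in_set => vx vy /and3P[xR yR xy].
have xC : x \in comp v.
  rewrite in_set; apply: connect_sub vx => a b /and3P[aC bC ab].
  by apply: connect1; rewrite /= !(subsetP (comp_rich vR)).
have yC := comp_step xC xR yR xy.
case/negP: vy; apply: connect_trans vx _.
by apply: connect1; rewrite /= xC yC.
Qed.

Lemma comp_disjoint u v : u \notin comp v -> [disjoint comp v & comp u].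
Proof.
move=> uv; rewrite disjoint_subset; apply/subsetP => w vw.
rewrite unfold_in /=; apply: contraNN uv => uw.
rewrite !in_set in uw vw *; apply: connect_trans vw _.
by rewrite (sym_connect_sym (induced_sym _ sE)).
Qed.

(** The component contains a non-neighbour [y] of the poor vertex [q]; otherwise [q] would have
    degree at least that of [v]. By the degree sum condition [y] has large degree, and its
    neighbours lie in the component or in [Q]. *)
Lemma card_comp v : Q != set0 -> v \in rich -> #|rich| < 3 * #|comp v|.
Proof.
case/set0Pn => q qQ vR; have Qrho := card_poor_le.
have dq : degree E q < rho by move: qQ; rewrite inE.
have dv : rho <= degree E v by move: vR; rewrite !inE -leqNgt.
have compQ w : w \in comp v -> w \notin Q.
  by move=> /(subsetP (comp_rich vR)); rewrite in_setC.
have cD := cardsD1 q Q; rewrite qQ in cD.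
have cR := card_setC_add Q.
have [y yC qy] : exists2 y, y \in comp v & ~~ E q y.
  apply: contrapT => no.
  have sub : comp v :|: Q :\ q \subset nbrs E q.
    apply/subsetP => w /setUP[wC|/setD1P[wq wQ]]; rewrite in_nbrs.
      by apply: contrapT => /negP qw; apply: no; exists w.
    by apply: poor_clique; rewrite // eq_sym.
  have cUI : #|comp v :|: Q :\ q| = #|comp v| + #|Q :\ q|.
    rewrite cardsU (_ : _ :&: _ = set0) ?cards0 ?subn0 //.
    apply/setP => w; rewrite in_set0; apply/negP => /setIP[/compQ wQ /setD1P[_]].
    by rewrite (negPf wQ).
  have := subset_leq_card sub; rewrite cUI -/(degree E q).
  have : v |: nbrs E v \subset comp v :|: Q.
    apply/subsetP => w /setU1P[->|]; first by rewrite in_setU comp_self.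
    rewrite in_nbrs in_setU => vw; have [wQ|wQ] := boolP (w \in Q);
      first by rewrite orbT.
    by rewrite (comp_step (comp_self v) vR _ vw) // in_setC.
  move=> /subset_leq_card; rewrite cardsU1 in_nbrs iE /= add1n => h1.
  have := leq_trans h1 (leq_card_setU _ _).1.
  move: dq dv cD; rewrite /degree -/(nbrs E q) -/(nbrs E v); clear.
  by move: #|nbrs E q| #|nbrs E v| #|comp v| #|Q :\ q| #|Q| => *; lia.
have yQ := compQ y yC.
have yq : q != y by apply: contraNneq yQ => <-.
have : y |: nbrs E y \subset comp v :|: Q :\ q.
  apply/subsetP => w /setU1P[->|]; first by rewrite in_setU yC.
  rewrite in_nbrs in_setU => yw; have [wQ|wQ] := boolP (w \in Q).
    by rewrite in_setD1 wQ andbT; apply/orP; right; apply: contraNneq qy => <-;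
      rewrite sE.
  by rewrite (comp_step yC _ _ yw) // in_setC.
move=> /subset_leq_card; rewrite cardsU1 in_nbrs iE /= add1n => h1.
have := leq_trans h1 (leq_card_setU _ _).1.
have := ore yq qy; move: dq cD cR Qrho k2; rewrite /degree -/(nbrs E q) -/(nbrs E y);
  clear.
by move: #|nbrs E q| #|nbrs E y| #|comp v| #|Q :\ q| #|Q| #|~: _| => *; lia.
Qed.

(* Otherwise three components would be pairwise disjoint. *)
Lemma comp_two x y z : Q != set0 -> x \in rich -> y \in rich -> z \in rich ->
  y \notin comp x -> z \notin comp x -> z \in comp y.
Proof.
move=> Q0 xR yR zR yx zx; apply: contrapT => /negP zy.
have := card_comp Q0 xR; have := card_comp Q0 yR; have := card_comp Q0 zR.
have dxy := comp_disjoint yx; have dxz := comp_disjoint zx;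
  have dyz := comp_disjoint zy.
have : comp x :|: (comp y :|: comp z) \subset rich.
  by rewrite !subUset !comp_rich.
move=> /subset_leq_card; rewrite !cardsU.
rewrite (disjoint_setI0 dyz) setIUr (disjoint_setI0 dxy) (disjoint_setI0 dxz) setU0
  cards0 !subn0.
by move: #|comp x| #|comp y| #|comp z| #|rich|; clear => *; lia.
Qed.

(* Degree sums of [q1] and [q2] with vertices of the opposite sides that have no
   neighbour in [Q]. *)
Lemma two_sided_count q1 q2 C1 C2 : q1 \in Q -> q2 \in Q -> q1 != q2 ->
  C1 :|: C2 = rich -> [disjoint C1 & C2] ->
  (forall u v, u \in C1 -> v \in C2 -> ~~ E u v) ->
  q1 \notin B -> q2 \notin B ->
  (forall v, v \in C2 -> ~~ E q1 v) -> (forall v, v \in C1 -> ~~ E q2 v) ->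
  #|rich| < 3 * #|C1| -> #|rich| < 3 * #|C2| ->
  0 < #|nbrs E q1 :&: C1| -> 0 < #|nbrs E q2 :&: C2| ->
  (forall q, q \in Q -> q \notin B -> #|nbrs E q :&: C1| <= #|nbrs E q1 :&: C1|) ->
  (forall q, q \in Q -> q \notin B -> #|nbrs E q :&: C2| <= #|nbrs E q2 :&: C2|) ->
  (k - #|nbrs E q1 :&: C1|) + (k - #|nbrs E q2 :&: C2|) + 2 <= #|Q|.
Proof.
move=> q1Q q2Q q12 C12 disC noC q1B q2B q1C2 q2C1 big1 big2 a0 b0 max1 max2.
have degQ q C C' : q \in Q -> C :|: C' = rich -> (forall v, v \in C' -> ~~ E q v) ->
    degree E q < #|Q| + #|nbrs E q :&: C|.
  move=> qQ CC qC'.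
  have : nbrs E q \subset (Q :\ q) :|: (nbrs E q :&: C).
    apply/subsetP => w; rewrite in_nbrs in_setU in_setD1 in_setI in_nbrs => qw;
      rewrite qw /=.
    have [wQ|wQ] := boolP (w \in Q).
      by rewrite andbT; apply/orP; left; apply: contraTneq qw => ->; rewrite iE.
    have : w \in C :|: C' by rewrite CC in_setC.
    by rewrite in_setU => /orP[->|/qC']; rewrite ?orbT // qw.
  move=> /subset_leq_card /leq_trans h.
  by rewrite (cardsD1 q Q) qQ add1n addSn ltnS; exact: h (leq_card_setU _ _).1.
have d1 := degQ q1 C1 C2 q1Q C12 q1C2.
have d2 : degree E q2 < #|Q| + #|nbrs E q2 :&: C2|.
  by apply: (degQ q2 C2 C1) => //; rewrite setUC.
have k1 : k < degree E q1 by move: q1B; rewrite inE -ltnNge.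
have k3 : k < degree E q2 by move: q2B; rewrite inE -ltnNge.
have cR := card_setC_add Q; have on := order_ge.
have Q2 : 1 < #|Q| by apply/card_gt1P; exists q1, q2.
(* If one side has no shortfall, the degree of the other vertex, at least [k.+1], already gives the
   bound. *)
have [ak|ak] := leqP k #|nbrs E q1 :&: C1|.
  by move: d2 k3 ak b0 Q2;
    move: #|nbrs E q1 :&: C1| #|nbrs E q2 :&: C2| #|Q| (degree E q2); clear => *; lia.
have [bk|bk] := leqP k #|nbrs E q2 :&: C2|.
  by move: d1 k1 bk a0 Q2;
    move: #|nbrs E q1 :&: C1| #|nbrs E q2 :&: C2| #|Q| (degree E q1); clear => *; lia.
have [Qk|Qk] := leqP (2 * k) #|Q|.
  by move: a0 b0 Qk ak bk; move: #|nbrs E q1 :&: C1| #|nbrs E q2 :&: C2| #|Q|;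
    clear => *; lia.
(* Each poor vertex has at most [k] neighbours in [C], by smallness or by maximality, so fewer than
   [2 * k * k] vertices of [C] have a poor neighbour, while [C] is larger. *)
have far C q0 : #|rich| < 3 * #|C| -> #|nbrs E q0 :&: C| < k ->
    (forall q, q \in Q -> q \notin B -> #|nbrs E q :&: C| <= #|nbrs E q0 :&: C|) ->
    exists2 p, p \in C & forall q, q \in Q -> ~~ E p q.
  move=> bigC ltk maxC; apply: contrapT => no.
  have : #|C| * 1 <= \sum_(q in Q) #|nbrs E q :&: C|.
    apply: leq_sum_nbrs => // w wC; apply/card_gt0P; apply: contrapT => none.
    apply: no; exists w => // q qQ; apply/negP => wq; apply: none.
    by exists q; rewrite in_setI in_nbrs wq.
  have : \sum_(q in Q) #|nbrs E q :&: C| <= \sum_(q in Q) k.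
    apply: leq_sum => q qQ; have [qB|qB] := boolP (q \in B).
      apply: leq_trans (subset_leq_card (subsetIl _ _)) _.
      by move: qB; rewrite inE.
    by apply: leq_trans (maxC q qQ qB) (ltnW ltk).
  rewrite sum_nat_const muln1 => h1 h2; have := leq_trans h2 h1.
  have : #|Q| * k <= 2 * k * k by rewrite leq_mul2r (ltnW Qk) orbT.
  move: cR on bigC Qk k2; move: #|C| #|Q| #|rich|; clear => c q r.
  by nia.
have [p1 p1C p1Q] := far C1 q1 big1 ak max1.
have [p2 p2C p2Q] := far C2 q2 big2 bk max2.
have degp p C C' : p \in C -> C :|: C' = rich ->
    (forall v, v \in C' -> ~~ E p v) -> (forall q, q \in Q -> ~~ E p q) ->
    degree E p < #|C|.
  move=> pC CC pC' pQ; rewrite (cardsD1 p C) pC add1n ltnS; apply: subset_leq_card.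
  apply/subsetP => w; rewrite in_set in_setD1 => pw.
  have wQ : w \notin Q by apply: contraTN pw => /pQ.
  have : w \in C :|: C' by rewrite CC in_setC.
  rewrite in_setU => /orP[->|/pC']; last by rewrite pw.
  by rewrite andbT; apply: contraTneq pw => ->; rewrite iE.
have dp1 := degp p1 C1 C2 p1C C12 (fun v => noC p1 v p1C) p1Q.
have dp2 : degree E p2 < #|C2|.
  by apply: (degp p2 C2 C1) => //; [rewrite setUC | move=> v vC1; rewrite sE noC].
have nQ p : p \in rich -> p \notin Q by rewrite in_setC.
have p1N : p1 \notin Q by apply: nQ; rewrite -C12 in_setU p1C.
have p2N : p2 \notin Q by apply: nQ; rewrite -C12 in_setU p2C orbT.
have o1 : n + 2 * k <= 2 * (degree E p1 + degree E q2) + 2.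
  by apply: ore; [apply: contraNneq p1N => -> | exact: p1Q].
have o2 : n + 2 * k <= 2 * (degree E p2 + degree E q1) + 2.
  by apply: ore; [apply: contraNneq p2N => -> | exact: p2Q].
have cC : #|C1| + #|C2| = #|rich|.
  by rewrite -C12 cardsU (disjoint_setI0 disC) cards0 subn0.
(* Adding [o1] and [o2] and inserting the four degree bounds gives exactly the claim, with nothing
   to spare. *)
move: d1 d2 dp1 dp2 o1 o2 cC cR ak bk.
move: #|nbrs E q1 :&: C1| #|nbrs E q2 :&: C2| #|Q| #|C1| #|C2| #|rich|.
move: (degree E q1) (degree E q2) (degree E p1) (degree E p2).
by clear => *; lia.
Qed.

(** The cases are: all poor vertices small, one non-small poor vertex sufficing to connect the rich
    part, or two being needed. *)
Lemma no_blocking_set_ST : has_2k_ST k E.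
Proof.
have [QB|] := boolP (Q \subset B); first exact: ST_poor_small.
case/subsetPn => q0 q0Q q0B.
have Q0 : Q != set0 by apply/set0Pn; exists q0.
have connB := connected_on_nonsmall sE noblock.
have richB v : v \in rich -> v \notin B.
  by rewrite in_setC; apply: contraNN; exact: (subsetP small_sub_poor).
have [v0 v0R] : exists v, v \in rich.
  apply/card_gt0P; have := card_setC_add Q; have := card_poor_le; have := order_ge.
  by move: k2; move: #|rich| #|Q|; clear => *; nia.
(* [G - B] is connected and meets both [Q] and its complement, so some [q] in [Q :\: B] has a rich
   neighbour [x]. *)
have [|||q [x [/setIP[]]]] := @connected_on_exit _ E (~: B) Q q0 v0 connB _ _ q0Q.
- by rewrite in_setC.
- by rewrite in_setC richB.
- by rewrite -in_setC.
rewrite in_setC => qB qQ /setDP[_ xQ] qx.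
have xR : x \in rich by rewrite in_setC.
have [allC|] := boolP (rich \subset comp x).
  apply: (ST_one_poor qQ qB).
  have -> : rich = comp x by apply/eqP; rewrite eqEsubset allC comp_rich.
  exact: connected_onU sE (@connected_on1 _ E q) (comp_connected xR) (set11 q)
    (comp_self x) qx.
case/subsetPn => y yR yx.
pose C1 := comp x; pose C2 := comp y.
have disC : [disjoint C1 & C2] by exact: comp_disjoint.
have C12 : C1 :|: C2 = rich.
  apply/eqP; rewrite eqEsubset subUset !comp_rich //=; apply/subsetP => z zR.
  rewrite in_setU; have [//|zx] := boolP (z \in C1).
  exact: (comp_two Q0 xR).
have noC u v : u \in C1 -> v \in C2 -> ~~ E u v.
  move=> uC1 vC2; apply/negP => uv.
  have uR := subsetP (comp_rich xR) _ uC1; have vR := subsetP (comp_rich yR) _ vC2.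
  by have := disjointFr disC (comp_step uC1 uR vR uv); rewrite vC2.
(* An edge leaving [C2] within [G - B] must end at a poor vertex [w], as no edge joins [C1] to
   [C2]. *)
have [|||q' [w [/setIP[_ q'C] /setDP[wB wC] q'w]]] :=
  @connected_on_exit _ E (~: B) C2 y x connB _ _ (comp_self y).
- by rewrite in_setC richB.
- by rewrite in_setC richB.
- by rewrite (disjointFr disC) // comp_self.
have wQ : w \in Q.
  apply: contrapT => /negP wQ; have : w \in C1 :|: C2 by rewrite C12 in_setC.
  rewrite in_setU (negPf wC) orbF => wC1.
  by have := noC w q' wC1 q'C; rewrite sE q'w.
rewrite in_setC in wB.
have [[p [[pQ pB] [p1 p1C pp1] [p2 p2C pp2]]]|none] := pselect (exists p,
    [/\ p \in Q /\ p \notin B, exists2 u, u \in C1 & E p u & exists2 u, u \in C2 & E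
      p u]).
  apply: (ST_one_poor pQ pB); rewrite -C12 setUA.
  apply: (connected_onU sE _ (comp_connected yR) _ p2C pp2); last by rewrite setU11.
  exact: connected_onU sE (@connected_on1 _ E p) (comp_connected xR) (set11 p) p1C
    pp1.
pose D := Q :\: B.
have qD : q \in D by rewrite in_setD qB.
have wD : w \in D by rewrite in_setD wB.
(* Maximality of the numbers of neighbours on each side is what [two_sided_count] needs to find
   vertices far from [Q]. *)
have [q1 q1D max1] := @arg_maxnP _ q (mem D) (fun z => #|nbrs E z :&: C1|) qD.
have [q2 q2D max2] := @arg_maxnP _ w (mem D) (fun z => #|nbrs E z :&: C2|) wD.
have /setDP[q1Q q1B] := q1D; have /setDP[q2Q q2B] := q2D.
have a0 : 0 < #|nbrs E q1 :&: C1|.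
  apply: leq_trans (max1 q qD); apply/card_gt0P; exists x.
  by rewrite in_setI in_nbrs qx comp_self.
have b0 : 0 < #|nbrs E q2 :&: C2|.
  apply: leq_trans (max2 w wD); apply/card_gt0P; exists q'.
  by rewrite in_setI in_nbrs sE q'w.
have [u1 /setIP[q1u1 u1C]] : exists u, u \in nbrs E q1 :&: C1 by apply/card_gt0P.
have [u2 /setIP[q2u2 u2C]] : exists u, u \in nbrs E q2 :&: C2 by apply/card_gt0P.
rewrite in_nbrs in q1u1; rewrite in_nbrs in q2u2.
have q1C2 v : v \in C2 -> ~~ E q1 v.
  by move=> vC; apply/negP => q1v; apply: none; exists q1; split;
    [|exists u1|exists v].
have q2C1 v : v \in C1 -> ~~ E q2 v.
  by move=> vC; apply/negP => q2v; apply: none; exists q2; split;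
    [|exists v|exists u2].
have q12 : q1 != q2 by apply: contraTneq q2u2 => <-; exact: q1C2.
apply: (ST_two_poor q1Q q2Q q12 C12 disC noC q1C2 q2C1).
  have -> : [set q1; q2] :|: rich = ([set q1] :|: C1) :|: ([set q2] :|: C2).
    by rewrite -C12 setUACA.
  have c1 := connected_onU sE (@connected_on1 _ E q1) (comp_connected xR) (set11 q1)
    u1C q1u1.
  have c2 := connected_onU sE (@connected_on1 _ E q2) (comp_connected yR) (set11 q2)
    u2C q2u2.
  by apply: (connected_onU sE c1 c2 _ _ (poor_clique q1Q q2Q q12)); rewrite setU11.
apply: two_sided_count => //; try exact: card_comp.
- by move=> z zQ zB; have zD : z \in D by [rewrite in_setD zB]; exact: max1 zD.
- by move=> z zQ zB; have zD : z \in D by [rewrite in_setD zB]; exact: max2 zD.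
Qed.

End Construction.

(** * From the real-valued hypotheses to the theorem *)

Lemma sigma2_degree_sum (R : realType) (V : finType) (E : rel V) (k : nat) (u v : V) :
  (((#|V|%:R + 2 * k%:R - 2) / 2 : R)%:E <= sigma2 R E)%E ->
  u != v -> ~~ E u v -> #|V| + 2 * k <= 2 * (degree E u + degree E v) + 2.
Proof.
move=> hs uv nuv.
have := @bigmin_le_cond _ _ _ (+oo%E : \bar R) (u, v)
  (fun p => (p.1 != p.2) && ~~ E p.1 p.2)
  (fun p => ((degree E p.1 + degree E p.2)%:R)%:E).
rewrite /= uv nuv => /(_ isT) /(le_trans hs); rewrite lee_fin natrD => h.
by rewrite -(ler_nat R) !(natrD, natrM); lra.
Qed.

Local Open Scope ring_scope.

Theorem theorem1p2 (R : realType) (k : nat) (k_ge2 : (2 <= k)%N)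
    (n1 : nat) (n1P : is_n1 R k n1)
    (V : finType) (E : rel V)
    (E_simple : simple_graph E) (E_conn : graph_connected E)
    (V_ge : (n1 <= #|V|)%N)
    (sigma2_ge : (((#|V|%:R + 2 * k%:R - 2) / 2 : R)%:E <= sigma2 R E)%E) :
  has_2k_ST k E <-> ~ (exists U : {set V}, blocking_set k E U).
Proof.
have [sE iE] := E_simple; split; first exact: ST_no_blocking_set.
apply: no_blocking_set_ST => //.
- exact: large_order_n1 n1P V_ge.
- by move=> u v; exact: sigma2_degree_sum sigma2_ge.
Qed.
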